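(* Let $d\ge 2$ and let $E\subset\mathbb{R}^d$ with $\dim_{\mathcal H}(E)>d-1$. Then for almost every $a\in\mathbb{R}^d$, $$\mathcal{L}\big(\{r>0:\ E\text{ determines } S^{d-1}_{a,r}\}\big)>0 .$$
   Context: $\dim_{\mathcal H}$ denotes Hausdorff dimension and $\mathcal{L}$ denotes one-dimensional Lebesgue measure; ''almost every'' is with respect to Lebesgue measure on $\mathbb{R}^d$. $S^{d-1}_{a,r}=\{x\in\mathbb{R}^d:|x-a|=r\}$ is the $(d-1)$-dimensional sphere with center $a$ and radius $r$. A ($(d-1)$-dimensional) sphere is determined by a $(d+1)$-tuple $(x^1,\dots,x^{d+1})$ of points of $\mathbb{R}^d$ if it is the unique sphere passing through all of the points $x^1,\dots,x^{d+1}$; a sphere is determined by a set $E$ if it is determined by some $(d+1)$-tuple $(x^1,\dots,x^{d+1})\in E\times\cdots\times E$.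
   Formalization: The set E is assumed to be Borel; for arbitrary E the claim fails in ZFC, since a transfinite construction gives a set of dimension d that determines at most one sphere about each centre a. *)

(* Defs.v *)
From HB Require Import structures.
From mathcomp Require Import all_boot all_order all_algebra.
From mathcomp Require Import all_classical all_reals all_analysis.

Set Implicit Arguments.
Unset Strict Implicit.
Unset Printing Implicit Defensive.

Import Order.TTheory GRing.Theory Num.Theory.
Import numFieldNormedType.Exports.

Local Open Scope classical_set_scope.
Local Open Scope ring_scope.

(* The canonical norm of MathComp-Analysis on row vectors is the sup norm, so
   the Euclidean norm is introduced here. The two induce the same topology. *)
Definition enorm (R : realType) (d : nat) (x : 'rV[R]_d) : R :=
  Num.sqrt (\sum_(i < d) x ord0 i ^+ 2).

Definition sphere (R : realType) (d : nat) (a : 'rV[R]_d) (r : R) :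
    set 'rV[R]_d :=
  [set x | enorm (x - a) = r].

(* Only spheres of positive radius count as (d-1)-dimensional spheres. *)
Definition tuple_determines_sphere (R : realType) (d : nat)
    (x : 'I_d.+1 -> 'rV[R]_d) (a : 'rV[R]_d) (r : R) : Prop :=
  [/\ 0 < r,
      forall i, sphere a r (x i) &
      forall (b : 'rV[R]_d) (s : R), 0 < s ->
        (forall i, sphere b s (x i)) -> sphere b s = sphere a r].

Definition set_determines_sphere (R : realType) (d : nat)
    (E : set 'rV[R]_d) (a : 'rV[R]_d) (r : R) : Prop :=
  exists2 x : 'I_d.+1 -> 'rV[R]_d,
    forall i, E (x i) & tuple_determines_sphere x a r.

(* This is -oo for U = set0; it is only used on nonempty sets or as an upper
   bounded quantity. *)
Definition ediam (R : realType) (d : nat) (U : set 'rV[R]_d) : \bar R :=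
  ereal_sup [set (enorm (p.1 - p.2))%:E | p in U `*` U].

(* The value at set0 is 0 for every s, while a singleton has value 0 `^ 0 = 1
   for s = 0, so that the 0-dimensional measure below is the counting measure *)
Definition hausdorff_gauge (R : realType) (d : nat) (s : R)
    (U : set 'rV[R]_d) : \bar R :=
  if U == set0 then 0%E else poweR (ediam U) s.

Definition hausdorff_content (R : realType) (d : nat) (s delta : R)
    (A : set 'rV[R]_d) : \bar R :=
  ereal_inf [set (\sum_(0 <= k <oo) hausdorff_gauge s (U k))%E |
    U in [set U : nat -> set 'rV[R]_d |
      (forall k, (ediam (U k) <= delta%:E)%E) /\ A `<=` \bigcup_k U k]].

Definition hausdorff_measure (R : realType) (d : nat) (s : R)
    (A : set 'rV[R]_d) : \bar R :=
  ereal_sup [set hausdorff_content s delta A |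
    delta in [set delta : R | 0 < delta]].

Definition hausdorff_dim (R : realType) (d : nat) (A : set 'rV[R]_d) : \bar R :=
  ereal_inf [set s%:E |
    s in [set s : R | 0 <= s /\ hausdorff_measure s A = 0%E]].

Definition box (R : realType) (d : nat) (p : 'rV[R]_d * 'rV[R]_d) :
    set 'rV[R]_d :=
  [set x | forall i, p.1 ord0 i <= x ord0 i <= p.2 ord0 i].

Definition box_volume (R : realType) (d : nat) (p : 'rV[R]_d * 'rV[R]_d) : R :=
  \prod_(i < d) Num.max 0 (p.2 ord0 i - p.1 ord0 i).

Definition lebesgue_outer_measure (R : realType) (d : nat)
    (A : set 'rV[R]_d) : \bar R :=
  ereal_inf [set (\sum_(0 <= k <oo) (box_volume (B k))%:E)%E |
    B in [set B : nat -> 'rV[R]_d * 'rV[R]_d |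
      A `<=` \bigcup_k box (B k)]].

Definition lebesgue_ae (R : realType) (d : nat) (P : 'rV[R]_d -> Prop) : Prop :=
  lebesgue_outer_measure [set x | ~ P x] = 0%E.

(* Arbitrary sets E must be excluded from results such as "dim E > d - 1
   implies that E determines many spheres": transfinite induction yields a
   non-measurable E of full outer measure in which, for each a, at most one
   sphere centered at a is determined by E. *)
Definition borel (R : realType) (d : nat) : set (set 'rV[R]_d) :=
  <<s @open 'rV[R]_d >>.

(* Main.v *)
(* Let d - 1 < s < dim E. If E does not determine the sphere S(a, r), then the
   slice of E by S(a, r) lies in a hyperplane, hence in a (d - 2)-sphere, which
   meets only O(2 ^ (k (d - 2))) dyadic cubes of generation k. The dyadic net
   content is a capacity for which Borel sets are capacitable, so there are
   decreasing compact sets K_n with intersection inside E and s-content at least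
   t > 0. A greedy version of Frostman's lemma puts on each K_n a finitely
   supported measure mu_n of mass t giving mass at most 2 ^ (- l s) to every cube
   of generation l <= n. As |x - a|^2 - |y - a|^2 is affine in a, the mass
   G_{n,k}(a) of the pairs (x, y) at distance at most 2 ^ - k lying in a common
   shell of width 2 ^ - n around a has average O(2 ^ - n 2 ^ (- k (s - 1))) in a.
   If almost no sphere centered at a is determined by E, compactness shows that
   for n large all but few of these shells meet K_n in O(2 ^ (k (d - 2))) cubes
   of generation k, and the Cauchy-Schwarz inequality bounds 2 ^ n G_{n,k}(a) from
   below by a multiple of 2 ^ (- k (d - 2)); the remaining shells are controlled
   by G_{n,0}(a). Since s - 1 > d - 2, Chebyshev's inequality and Fatou's lemma
   show that the set of these a is null. *)
Require Import Defs.
From HB Require Import structures.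
From mathcomp Require Import all_boot all_order all_algebra.
From mathcomp Require Import all_classical all_reals all_analysis.
From mathcomp Require Import ring lra zify.

Set Implicit Arguments.
Unset Strict Implicit.
Unset Printing Implicit Defensive.

Import Order.TTheory GRing.Theory Num.Theory.
Import numFieldNormedType.Exports.

Local Open Scope classical_set_scope.
Local Open Scope ring_scope.

(** * Slices contained in a hyperplane *)

(** Neither the set of exceptional centres nor, for a fixed centre, the set of determined radii is
    known to be measurable. Both are only compared with unions of dyadic pieces of generation n: the
    exceptional centres in a bounded region lie, for all large n, in finite unions of cells of small
    volume, and a null set of radii contains a decreasing intersection of unions of intervals.
    Letting n grow is then continuity of a measure along measurable sets; mu_n is used at generation
    n alone, and no weak limit is taken. The order of the choices matters: k and the threshold on
    G_{n,0} depend only on the volume allowed for the exceptional centres, whereas the n from which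
    on few shells are thick depends on the centre. The thick shells can be handled with k = 0
    because any shell meets boundedly many unit cubes, while the number of thick shells is o(2^n).
    With z = 2^-s, the condition s > d - 1 reads 2^(d-1) z < 1: the energy bound (2z)^k times the
    count 2^(k(d-2)) is the geometric sequence (2^(d-1) z)^k, up to constants. *)

(** Greedy choice of independent vectors in [Z]: fewer than [m] rows have a common nonzero
    annihilator, and an element of [Z] that it does not kill is independent of these rows. Taking
    [r = m] separates slices inside a hyperplane from slices containing a full affinely independent
    tuple. *)
Lemma annihilator_or_row_free (F : fieldType) (m : nat) (Z : set 'rV[F]_m) (r : nat) :
  (r <= m)%N ->
  (exists2 u : 'cV[F]_m, u != 0 & forall z, Z z -> z *m u = 0) \/
  (exists2 M : 'M[F]_(r, m), (forall i, Z (row i M)) & row_free M).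
Proof.
elim: r => [|r IH] rm.
  by right; exists 0; [case|rewrite /row_free mxrank0].
have [|[M MZ Mfree]] := IH (ltnW rm); first by left.
have [u u0 Mu] : exists2 u : 'cV[F]_m, u != 0 & M *m u = 0.
  have : cokermx M != 0.
    rewrite -mxrank_eq0 mxrank_coker subn_eq0 -ltnNge.
    by move/eqP: Mfree => ->.
  case/matrix0Pn => i [j ij]; exists (col j (cokermx M)).
    by apply/matrix0Pn; exists i, ord0; rewrite mxE.
  by rewrite colE mulmxA mulmx_coker mul0mx.
have [uZ|] := pselect (forall z, Z z -> z *m u = 0); first by left; exists u.
move/existsNP => [z /not_implyP[Zz zu]].
right; exists (col_mx z M : 'M[F]_(1 + r, m)).
  move=> i; case: (@split_ordP 1 r i) => j ->.
    have -> : row (lshift r j) (col_mx z M) = row j z := rowKu _ _ _.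
    by rewrite (ord1 j) row_id.
  by have -> : row (rshift 1 j) (col_mx z M) = row j M := rowKd _ _ _.
apply: inj_row_free => v vM.
pose a := lsubmx (v : 'rV[F]_(1 + r)); pose b := rsubmx (v : 'rV[F]_(1 + r)).
have vE : v = row_mx a b := esym (@hsubmxK F 1 1 r v).
have {}vM : a *m z + b *m M = 0 by rewrite -mul_row_col -vE.
have a0 : a = 0.
  have := congr1 (mulmx ^~ u) vM; rewrite mulmxDl -!mulmxA Mu mulmx0 addr0 mul0mx.
  rewrite [a]mx11_scalar mul_scalar_mx => /eqP; rewrite scaler_eq0.
  case/orP => [/eqP ->|/eqP//]; by rewrite raddf0.
move: vM; rewrite a0 mul0mx add0r => /eqP; rewrite -[X in _ == X](mul0mx _ M).
by rewrite vE a0 => /eqP/(row_free_inj Mfree) ->; rewrite row_mx0.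
Qed.

Lemma enorm_sqr (R : realType) (d : nat) (x : 'rV[R]_d) :
  enorm x ^+ 2 = \sum_(i < d) x ord0 i ^+ 2.
Proof. by rewrite sqr_sqrtr// sumr_ge0// => i _; rewrite sqr_ge0. Qed.

Lemma enorm_ge0 (R : realType) (d : nat) (x : 'rV[R]_d) : 0 <= enorm x.
Proof. exact: sqrtr_ge0. Qed.

(* If no hyperplane contains the slice, then d + 1 of its points are affinely
   independent, and two spheres through them coincide because the difference of
   their equations is affine. *)
Lemma undetermined_slice (R : realType) (d : nat) (E : set 'rV[R]_d.+1)
    (a : 'rV[R]_d.+1) (r : R) :
  ~ (0 < r /\ set_determines_sphere E a r) ->
  exists v : 'rV[R]_d.+1, exists c : R, v != 0 /\
    forall x, E x -> enorm (x - a) = r -> \sum_l v ord0 l * x ord0 l = c.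
Proof.
move=> nE.
pose e0 : 'rV[R]_d.+1 := delta_mx 0 0.
have e00 : e0 != 0 by apply/matrix0Pn; exists 0, 0; rewrite mxE !eqxx oner_neq0.
(* For [r <= 0] the slice is contained in {a}, and any hyperplane through [a] works. *)
have [r0|r0] := leP r 0.
  exists e0, (\sum_l e0 ord0 l * a ord0 l); split => // x _ xr.
  have : \sum_i (x - a) ord0 i ^+ 2 = 0.
    rewrite -enorm_sqr xr; have -> : r = 0; last by rewrite expr0n.
    by apply/le_anti; rewrite r0 -xr enorm_ge0.
  move/eqP; rewrite psumr_eq0; last by move=> i _; rewrite sqr_ge0.
  move/allP => xa; apply: eq_bigr => l _.
  have /implyP/(_ isT) := xa l (mem_index_enum _).
  by rewrite sqrf_eq0 !mxE subr_eq0 => /eqP ->.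
(* A leading coordinate 1 turns affine independence into linear independence. *)
pose Z := [set row_mx (1%:M : 'M[R]_1) x | x in E `&` sphere a r].
have [[u u0 uZ]|[M MZ Mfree]] := @annihilator_or_row_free _ (1 + d.+1) Z (1 + d.+1) (leqnn _).
  pose v := (dsubmx u)^T.
  have ux x : E x -> enorm (x - a) = r -> usubmx u ord0 ord0 + \sum_l v ord0 l * x ord0 l = 0.
    move=> Ex xr; have := uZ _ (ex_intro2 _ _ x (conj Ex xr) erefl).
    rewrite -{1}[u]vsubmxK mul_row_col mul1mx => /matrixP/(_ ord0 ord0).
    rewrite !mxE => uE; rewrite -[RHS]uE; congr +%R.
    by apply: eq_bigr => l _; rewrite !mxE mulrC.
  (* If the linear part vanishes, the relation equates a nonzero constant with 0: the slice is empty
     and any hyperplane contains it. *)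
  have [v0|v0] := eqVneq v 0; last first.
    exists v, (- usubmx u ord0 ord0); split => // x Ex xr.
    by apply/eqP; rewrite -addr_eq0 addrC ux.
  have u00 : usubmx u ord0 ord0 != 0.
    apply: contra_neq u0 => u00; rewrite -[u]vsubmxK.
    rewrite [usubmx u]mx11_scalar u00 -[dsubmx u]trmxK -/v v0 trmx0 raddf0.
    by rewrite col_mx0.
  exists e0, 0; split => // x Ex xr; have := ux x Ex xr.
  rewrite v0 big1 ?addr0; first by move/eqP; rewrite (negPf u00).
  by move=> l _; rewrite mxE mul0r.
exfalso; apply: nE; split => //.
have /choice[x xP] : forall i : 'I_d.+2, exists x, (E `&` sphere a r) x /\ row i M = row_mx 1%:M x.
  by move=> i; have [x Ex xi] := MZ i; exists x.
exists x; first by move=> i; case: (xP i) => -[].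
split => //; first by move=> i; case: (xP i) => -[].
move=> b s s0 xbs.
(* [w] and [k] are the coefficients of the affine function |x - b|^2 - s^2 - |x - a|^2 + r^2 of
   x. *)
pose w : 'cV[R]_d.+1 := \col_l (2 * (a ord0 l - b ord0 l)).
pose k := \sum_l (b ord0 l ^+ 2 - a ord0 l ^+ 2) - s ^+ 2 + r ^+ 2.
pose u : 'cV[R]_(1 + d.+1) := col_mx k%:M w.
have Mu : M *m u = 0.
  apply/row_matrixP => i; rewrite row_mul row0; case: (xP i) => -[_ xa] ->.
  rewrite mul_row_col mul1mx; apply/matrixP => i0 j0; rewrite !mxE !ord1 eqxx mulr1n.
  rewrite /k -(xbs i : enorm _ = s) -(xa : enorm _ = r) !enorm_sqr.
  rewrite -!sumrN -!big_split/=; apply: big1 => l _; rewrite !mxE; ring.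
have u0 : u = 0.
  by move: Mfree; rewrite row_free_unit => Mu1; rewrite -[u](mulKmx Mu1) Mu mulmx0.
have w0 l : a ord0 l = b ord0 l.
  have := congr1 dsubmx u0; rewrite col_mxKd => /matrixP/(_ l ord0).
  by rewrite !mxE => /eqP; rewrite mulf_eq0 pnatr_eq0/= subr_eq0 => /eqP.
have ab : b = a by apply/rowP => l; rewrite -w0 (ord1 ord0).
have : k = 0.
  have := congr1 usubmx u0; rewrite col_mxKu => /matrixP/(_ ord0 ord0).
  by rewrite !mxE eqxx mulr1n.
rewrite /k ab big1 ?add0r; last by move=> l _; rewrite subrr.
move=> /eqP; rewrite addrC subr_eq0 => /eqP rs.
have -> : s = r by apply/eqP; rewrite -(@eqrXn2 _ 2) ?ltW// rs.
by [].
Qed.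

(** * Dyadic cubes near a (d - 2)-sphere *)

(** The interval [-N, N) splits into this many dyadic intervals of length 2^-n. Indices are taken in
    ['I_(grid N n).+1] because the closed cube also contains the points with a coordinate equal to
    N. *)
Definition grid (N n : nat) : nat := 2 * N * 2 ^ n.

Lemma grid_le (R : realType) (N n : nat) :
  (grid N n).+1%:R <= (2 * N%:R + 1) * 2 ^+ n :> R.
Proof.
rewrite /grid -(natr1 (2 * N * 2 ^ n)) !natrM natrX [leRHS]mulrDl mul1r lerD2l.
by rewrite exprn_ege1// ler1n.
Qed.

Section Dyadic.
Context (R : realType) (d : nat).
Implicit Types (x y : 'rV[R]_d) (n N : nat).

Definition dyadic n x : 'rV[int]_d := \row_i Num.floor (2 ^+ n * x ord0 i).

Lemma dyadic_nested m n x y : (m <= n)%N -> dyadic n x = dyadic n y ->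
  dyadic m x = dyadic m y.
Proof.
elim: n => [|n IH]; first by rewrite leqn0 => /eqP ->.
rewrite leq_eqVlt => /orP[/eqP -> //|mn /rowP xy]; apply: IH => //.
apply/rowP => i; have := xy i; rewrite !mxE !exprS -!mulrA.
set u := 2 ^+ n * x ord0 i; set v := 2 ^+ n * y ord0 i => uv.
apply/esym/floor_def; have := floor_itv u; set k := Num.floor u => /andP[k1 k2].
have : (k * 2 <= Num.floor (2 * u))%R.
  by rewrite floor_ge_int intrM; lra.
have : (Num.floor (2 * u) < (k + 1) * 2)%R.
  by rewrite floor_lt_int intrM; lra.
rewrite uv floor_lt_int floor_ge_int !intrM => h1 h2; apply/andP; split; lra.
Qed.

Definition cube N : set 'rV[R]_d := [set x | forall i, `|x ord0 i| <= N%:R].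

(** On [cube N] this is [dyadic] shifted by N 2^n, with values in a finite type: [dyadic] serves the
    net content, [cell] serves the counting arguments. *)
Definition cell N n x : {ffun 'I_d -> 'I_(grid N n).+1} :=
  [ffun i => inord (Num.truncn (2 ^+ n * (x ord0 i + N%:R)))].

Definition corner N n (p : {ffun 'I_d -> 'I_(grid N n).+1}) : 'rV[R]_d :=
  \row_i ((p i)%:R / 2 ^+ n - N%:R).

Lemma cellE N n x i : cube N x ->
  cell N n x i = Num.truncn (2 ^+ n * (x ord0 i + N%:R)) :> nat.
Proof.
move=> /(_ i); rewrite ler_norml => /andP[x1 x2].
rewrite ffunE inordK// ltnS truncn_le_nat.
apply: (@le_lt_trans _ _ (grid N n)%:R); last by rewrite ltr_nat.
rewrite /grid natrM natrX mulrC ler_pM2r ?exprn_gt0//.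
by rewrite natrM; lra.
Qed.

Lemma cell_itv N n x i : cube N x ->
  corner (cell N n x) ord0 i <= x ord0 i < corner (cell N n x) ord0 i + 2 ^- n.
Proof.
move=> xN; rewrite mxE cellE//.
have x0 : 0 <= 2 ^+ n * (x ord0 i + N%:R).
  rewrite mulr_ge0 ?exprn_ge0//; have := xN i; rewrite ler_norml => /andP[]; lra.
have n0 : 0 < 2 ^+ n :> R by rewrite exprn_gt0.
have := truncn_itv x0; set k := Num.truncn _ => /andP[k1 k2].
rewrite lerBlDr ler_pdivrMr// mulrC k1/=.
rewrite addrAC ltrBrDr.
have -> : k%:R / 2 ^+ n + 2 ^- n = k.+1%:R / 2 ^+ n :> R.
  by rewrite -(natr1 k) mulrDl mul1r.
by rewrite ltr_pdivlMr// mulrC.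
Qed.

Lemma cell_dist N n x y i : cube N x -> cube N y -> cell N n x i = cell N n y i ->
  `|x ord0 i - y ord0 i| <= 2 ^- n.
Proof.
move=> xN yN xy; have := cell_itv n i yN; have := cell_itv n i xN.
by rewrite /corner !mxE xy ler_norml => /andP[? ?] /andP[? ?]; lra.
Qed.

Lemma cell_dyadic N n x y : cube N x -> cube N y -> cell N n x = cell N n y ->
  dyadic n x = dyadic n y.
Proof.
move=> xN yN xy.
have dE z i : cube N z ->
    dyadic n z ord0 i = (cell N n z i)%:Z - (2 ^ n * N)%N%:Z.
  move=> zN; rewrite mxE; apply: floor_def; rewrite cellE//.
  have z0 : 0 <= 2 ^+ n * (z ord0 i + N%:R).
    rewrite mulr_ge0 ?exprn_ge0//; have := zN i; rewrite ler_norml => /andP[]; lra.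
  have := truncn_itv z0; set k := Num.truncn _; rewrite -(natr1 k) mulrDr => /andP[k1 k2].
  rewrite !(intrD, intrN) -!pmulrn natrM natrX; apply/andP; split; lra.
by apply/rowP => i; rewrite !dE// xy.
Qed.

End Dyadic.

Section Circle.
Context (R : realType) (d : nat).
Implicit Types (v a z : 'rV[R]_d).

Definition slice_normal v a (i : 'I_d) z l : R :=
  (z ord0 l - a ord0 l) - (z ord0 i - a ord0 i) / v ord0 i * v ord0 l.

Definition off_dist (i j : 'I_d) z z' : R :=
  \sum_(l | (l != i) && (l != j)) `|z ord0 l - z' ord0 l|.

Lemma sum_off_dist (F : 'I_d -> R) (i j : 'I_d) : j != i ->
  \sum_l F l = F i + (F j + \sum_(l | (l != i) && (l != j)) F l).
Proof. by move=> ji; rewrite (bigD1 i)//= (bigD1 j)//=. Qed.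

(* The vector [slice_normal] is normal to the sphere within the hyperplane, up to a
   multiple of v killing the i-th coordinate. Convexity of the ball then bounds
   the variation of the coordinate where it is largest. *)
Lemma circle_lipschitz_signed v a z z' (c : R) i j : j != i -> v ord0 i != 0 ->
  \sum_l v ord0 l * z ord0 l = c -> \sum_l v ord0 l * z' ord0 l = c ->
  \sum_l (z ord0 l - a ord0 l) ^+ 2 = \sum_l (z' ord0 l - a ord0 l) ^+ 2 ->
  (forall l, `|slice_normal v a i z l| <= `|slice_normal v a i z j|) ->
  0 <= slice_normal v a i z j * (z' ord0 j - z ord0 j) ->
  `|z ord0 j - z' ord0 j| <= off_dist i j z z'.
Proof.
move=> ji vi zc zc' za tmax tj; set t := slice_normal v a i z in tmax tj *.
have off0 : 0 <= off_dist i j z z' by apply: sumr_ge0.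
have ti : t i = 0 by rewrite /t /slice_normal divfK ?subrr.
(* Equal distances to [a] give (z - a).(z' - z) = - |z' - z|^2 / 2. Since z' - z is orthogonal to
   [v], z - a may be replaced by [t], which differs from it by a multiple of [v]. *)
have tE : \sum_l t l * (z' ord0 l - z ord0 l) = - (\sum_l (z' ord0 l - z ord0 l) ^+ 2) / 2.
  have v0 : \sum_l v ord0 l * (z' ord0 l - z ord0 l) = 0.
    by under eq_bigr do rewrite mulrBr; rewrite sumrB zc zc' subrr.
  have a0 : \sum_l ((z ord0 l - a ord0 l) * (z' ord0 l - z ord0 l) * 2
      + (z' ord0 l - z ord0 l) ^+ 2) = 0.
    transitivity (\sum_l ((z' ord0 l - a ord0 l) ^+ 2 - (z ord0 l - a ord0 l) ^+ 2)).
      by apply: eq_bigr => l _; ring.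
    by rewrite sumrB za subrr.
  move: a0; rewrite big_split/= -mulr_suml => a0.
  transitivity (\sum_l ((z ord0 l - a ord0 l) * (z' ord0 l - z ord0 l)) -
     (z ord0 i - a ord0 i) / v ord0 i * \sum_l v ord0 l * (z' ord0 l - z ord0 l)).
    rewrite mulr_sumr -sumrB; apply: eq_bigr => l _; rewrite /t /slice_normal; ring.
  rewrite v0; lra.
have [t0|t0] := eqVneq (t j) 0.
  have tl l : t l = 0.
    by apply/eqP; rewrite -normr_le0 (le_trans (tmax l))// t0 normr0.
  have : \sum_l (z' ord0 l - z ord0 l) ^+ 2 = 0.
    by move: tE; rewrite big1 => [|l _]; [lra|rewrite tl mul0r].
  move/eqP; rewrite psumr_eq0; last by move=> l _; rewrite sqr_ge0.
  move/allP/(_ j (mem_index_enum _)) => /=; rewrite sqrf_eq0 => /eqP zj.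
  by rewrite distrC zj normr0.
rewrite -(ler_pM2l (_ : 0 < `|t j|)) ?normr_gt0//.
have -> : `|t j| * `|z ord0 j - z' ord0 j| = t j * (z' ord0 j - z ord0 j).
  by rewrite -(ger0_norm tj) normrM (distrC (z ord0 j)).
have : t j * (z' ord0 j - z ord0 j) <=
    - \sum_(l | (l != i) && (l != j)) t l * (z' ord0 l - z ord0 l).
  move: tE; rewrite (sum_off_dist _ ji) ti mul0r add0r => tE.
  have : 0 <= \sum_l (z' ord0 l - z ord0 l) ^+ 2.
    by apply: sumr_ge0 => l _; rewrite sqr_ge0.
  lra.
move=> /le_trans; apply; rewrite -sumrN mulr_sumr; apply: ler_sum => l _.
rewrite (le_trans (ler_norm _))// normrN normrM (distrC (z ord0 l)).
exact: ler_wpM2r.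
Qed.

(** The normals at [z] and [z'] have the same sign in coordinate j, so the signed estimate applies
    to one of the two orders of the points. Coordinate i is then recovered from the equation of the
    hyperplane, where the maximality of [v ord0 i] keeps the constants equal to 1. *)
Lemma circle_lipschitz v a z z' (c : R) i j : j != i -> v ord0 i != 0 ->
  (forall l, `|v ord0 l| <= `|v ord0 i|) ->
  \sum_l v ord0 l * z ord0 l = c -> \sum_l v ord0 l * z' ord0 l = c ->
  \sum_l (z ord0 l - a ord0 l) ^+ 2 = \sum_l (z' ord0 l - a ord0 l) ^+ 2 ->
  (forall l, `|slice_normal v a i z l| <= `|slice_normal v a i z j|) ->
  (forall l, `|slice_normal v a i z' l| <= `|slice_normal v a i z' j|) ->
  (0 <= slice_normal v a i z j) = (0 <= slice_normal v a i z' j) ->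
  `|z ord0 j - z' ord0 j| <= off_dist i j z z' /\
  `|z ord0 i - z' ord0 i| <= off_dist i j z z' + off_dist i j z z'.
Proof.
move=> ji vi vmax zc zc' za tm tm' tt.
have zj : `|z ord0 j - z' ord0 j| <= off_dist i j z z'.
  have offC : off_dist i j z' z = off_dist i j z z' by apply: eq_bigr => l _; rewrite distrC.
  have [zz|zz] := leP 0 (slice_normal v a i z j * (z' ord0 j - z ord0 j)).
    by apply: (circle_lipschitz_signed (c := c) (v := v) (a := a)).
  rewrite distrC -offC; apply: (circle_lipschitz_signed (c := c) (v := v) (a := a)) => //.
  have [t1|t1] := leP 0 (slice_normal v a i z j).
    have t2 : 0 <= slice_normal v a i z' j by rewrite -tt.
    apply: mulr_ge0 => //; rewrite subr_ge0 leNgt; apply/negP => lt_z.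
    by move: zz; rewrite ltNge mulr_ge0// subr_ge0 ltW.
  have t2 : slice_normal v a i z' j < 0 by rewrite ltNge -tt -ltNge.
  apply: mulr_le0; rewrite ?(ltW t2)// subr_le0 leNgt; apply/negP => lt_z.
  by move: zz; rewrite ltNge mulr_le0// ?ltW// subr_lt0.
split => //; apply: le_trans (_ : `|z ord0 j - z' ord0 j| + off_dist i j z z' <= _); last exact: lerD.
have : \sum_l v ord0 l * (z ord0 l - z' ord0 l) = 0.
  by under eq_bigr do rewrite mulrBr; rewrite sumrB zc zc' subrr.
rewrite (sum_off_dist _ ji) => /eqP; rewrite addr_eq0 => /eqP /(congr1 Num.norm).
rewrite normrM normrN => vE; rewrite -(ler_pM2l (_ : 0 < `|v ord0 i|)) ?normr_gt0//.
rewrite vE (le_trans (ler_normD _ _))// [X in _ <= X]mulrDr lerD//.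
  by rewrite normrM ler_wpM2r.
rewrite (le_trans (ler_norm_sum _ _ _))// mulr_sumr; apply: ler_sum => l _.
by rewrite normrM ler_wpM2r.
Qed.

End Circle.

Lemma card_fibers (T U : finType) (A : {set T}) (f : T -> U) (C : nat) :
  (forall u, (#|[set x in A | f x == u]%SET| <= C)%N) -> (#|A| <= #|U| * C)%N.
Proof.
move=> fC; rewrite -sum1_card (partition_big f xpredT)//=.
rewrite -sum_nat_const; apply: leq_sum => u _.
by rewrite sum1dep_card; exact: fC.
Qed.

Lemma card_spread (m : nat) (A : {set 'I_m}) (K : nat) :
  (forall i j, i \in A -> j \in A -> (i <= j + K)%N) -> (#|A| <= K.+1)%N.
Proof.
move=> AK; have [->|[a aA]] := set_0Vmem A; first by rewrite cards0.
pose b := [arg min_(i < a in A) nat_of_ord i]%N.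
have [bA bmin] : b \in A /\ forall i, i \in A -> (b <= i)%N.
  by rewrite /b; case: arg_minnP.
pose f (i : 'I_m) : 'I_K.+1 := inord (i - b).
rewrite -[K.+1]card_ord -(@card_in_imset _ _ f A) ?max_card// => i j iA jA.
move=> /(congr1 val); rewrite /= !inordK ?ltnS ?leq_subLR ?AK// => ij.
by apply/val_inj; rewrite /= -(subnK (bmin i iA)) ij subnK ?bmin.
Qed.

Section Counting.
Context (R : realType) (e N n : nat).
Local Notation d := e.+2.
Implicit Types (v a x z : 'rV[R]_d).
Local Notation point := {ffun 'I_d -> 'I_(grid N n).+1}.

(** Cells are sorted by the index [j] where the normal of their point [z] is largest, by the sign of
    the normal there, and by the [e] coordinates other than i and j. In one class, [z] varies by at
    most 3h in each of these [e] coordinates (h for the cell, h for each approximation), hence by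
    3eh in coordinate j and by 6eh in coordinate i. *)
Lemma card_near_circle v a (c r : R) (A : {set point}) : v != 0 ->
  (forall p, p \in A -> exists x z, [/\ cube N x, cell N n x = p,
     \sum_l v ord0 l * z ord0 l = c, \sum_l (z ord0 l - a ord0 l) ^+ 2 = r &
     forall l, `|x ord0 l - z ord0 l| <= 2 ^- n]) ->
  (#|A| <= (e.+1 * 2 * (grid N n).+1 ^ e) * ((3 * e).+4 * (6 * e).+4))%N.
Proof.
move=> v0 AP.
have [i vmax] : exists i, forall l, `|v ord0 l| <= `|v ord0 i|.
  exists [arg max_(l > ord0) `|v ord0 l|]%O.
  by case: arg_maxP => // i _ imax l; exact: imax.
have vi : v ord0 i != 0.
  apply: contra_neq v0 => vi; apply/rowP => l; rewrite mxE.
  by apply/eqP; rewrite -normr_le0 (le_trans (vmax l))// vi normr0.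
have /choice[w wP] p : exists xz : 'rV[R]_d * 'rV[R]_d, p \in A ->
    [/\ cube N xz.1, cell N n xz.1 = p,
     \sum_l v ord0 l * xz.2 ord0 l = c, \sum_l (xz.2 ord0 l - a ord0 l) ^+ 2 = r &
     forall l, `|xz.1 ord0 l - xz.2 ord0 l| <= 2 ^- n].
  have [/AP[x [z xz]]|pA] := boolP (p \in A); first by exists (x, z).
  by exists (0, 0).
pose z p := (w p).2.
pose t p l := slice_normal v a i (z p) l.
pose J p : 'I_e.+1 := [arg max_(j > ord0) `|t p (lift i j)|]%O.
have tJ p l : `|t p l| <= `|t p (lift i (J p))|.
  have [k ->|->] := unliftP i l.
    by rewrite /J; case: arg_maxP => // j _ jmax; exact: jmax.
  by rewrite /t /slice_normal divfK ?subrr ?normr0.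
pose F p : 'I_e.+1 * bool * {ffun 'I_e -> 'I_(grid N n).+1} :=
  (J p, 0 <= t p (lift i (J p)), [ffun k => p (lift i (lift (J p) k))]).
have -> : (e.+1 * 2 * (grid N n).+1 ^ e)%N = #|{: 'I_e.+1 * bool * {ffun 'I_e -> 'I_(grid N n).+1}}|.
  by rewrite !card_prod card_bool card_ffun !card_ord.
apply: (@card_fibers _ _ _ F) => -[[j b] g].
pose h : R := 2 ^- n.
have h0 : 0 < h by rewrite invr_gt0 exprn_gt0.
pose D : R := (3 * e)%:R * h.
have close p p' : p \in A -> p' \in A -> F p = (j, b, g) -> F p' = (j, b, g) ->
    `|z p ord0 (lift i j) - z p' ord0 (lift i j)| <= D /\
    `|z p ord0 i - z p' ord0 i| <= D + D.
  move=> pA p'A [Jp bp gp] [Jp' bp' gp'].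
  have [xN xp vz zr xz] := wP p pA; have [xN' xp' vz' zr' xz'] := wP p' p'A.
  have ji : lift i j != i by rewrite eq_sym neq_lift.
  have zz l : (l != i) && (l != lift i j) -> `|z p ord0 l - z p' ord0 l| <= 3 * h.
    case: (unliftP i l) => [k ->|->]; rewrite ?eqxx//= => /andP[_].
    case: (unliftP j k) => [k' ->|->]; rewrite ?eqxx//= => _.
    have := congr1 (fun f : {ffun _ -> _} => f k') gp'; rewrite -gp !ffunE Jp Jp' => pp.
    have := @cell_dist R d N n (w p).1 (w p').1 (lift i (lift j k')) xN xN'.
    rewrite xp xp' pp => /(_ erefl).
    have := xz (lift i (lift j k')); have := xz' (lift i (lift j k')).
    rewrite -/(z p) -/(z p') -/h !ler_norml => /andP[? ?] /andP[? ?] /andP[? ?].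
    by apply/andP; split; lra.
  have offD : off_dist i (lift i j) (z p) (z p') <= D.
    apply: le_trans (_ : \sum_(l | (l != i) && (l != lift i j)) 3 * h <= _).
      exact: ler_sum.
    rewrite sumr_const /D natrM -[(3 * h) *+ _]mulr_natr mulrAC ler_pM2r// ler_pM2l// ler_nat.
    have -> : #|[pred l | (l != i) && (l != lift i j)]| = #|~: [set i; lift i j]|.
      by apply: eq_card => l; rewrite !inE negb_or.
    by rewrite cardsCs finset.setCK cards2 card_ord neq_lift !subSS subn0.
  have tp : (0 <= t p (lift i j)) = (0 <= t p' (lift i j)).
    by rewrite -[in LHS]Jp -[in RHS]Jp' bp bp'.
  have [] := @circle_lipschitz R d v a (z p) (z p') c i (lift i j) ji vi vmax vz vz'
    (etrans zr (esym zr')) _ _ tp.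
  - by move=> l; have := tJ p l; rewrite Jp.
  - by move=> l; have := tJ p' l; rewrite Jp'.
  - by move=> z1 z2; split; [exact: le_trans z1 _|apply: le_trans z2 _; exact: lerD].
pose S := [set p in A | F p == (j, b, g)]%SET.
have SP p : p \in S -> p \in A /\ F p = (j, b, g) by rewrite inE => /andP[? /eqP].
(* Passing from [z] to [x] costs h for each point, and from [x] to the corner h once more: indices
   differ by at most K + 3, which leaves K + 4 values. *)
have spread l (K : nat) : (forall p p', p \in S -> p' \in S ->
    `|z p ord0 l - z p' ord0 l| <= K%:R * h) ->
    (#|[set p l | p : point in S]%SET| <= K.+4)%N.
  move=> zK; apply: card_spread => _ _ /imsetP[p pS ->] /imsetP[p' p'S ->].
  have [[pA _] [p'A _]] := (SP p pS, SP p' p'S).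
  have [xN xp _ _ xz] := wP p pA; have [xN' xp' _ _ xz'] := wP p' p'A.
  have := cell_itv n l xN; have := cell_itv n l xN'; rewrite xp xp' !mxE.
  have := xz l; have := xz' l; have := zK p p' pS p'S.
  rewrite -/(z p) -/(z p') -/h !ler_norml => /andP[? ?] /andP[? ?] /andP[? ?].
  move=> /andP[? ?] /andP[? ?].
  rewrite -(ler_nat R) -(ler_pM2r h0) natrD mulrDl -addn3 natrD; lra.
have inj_p : {in S &, injective (fun p : point => (p (lift i j), p i))}.
  move=> p p' /SP[_ [Jp _ gp]] /SP[_ [Jp' _ gp']] [pj pi]; apply/ffunP => l.
  case: (unliftP i l) => [k ->|->//]; case: (unliftP j k) => [k' ->|->//].
  by have := congr1 (fun f : {ffun _ -> _} => f k') gp'; rewrite -gp !ffunE Jp Jp'.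
rewrite -/S -(card_in_imset inj_p).
apply: leq_trans (subset_leq_card (_ : _ \subset finset.setX
   [set p (lift i j) | p : point in S]%SET [set p i | p : point in S]%SET)) _.
  by apply/fintype.subsetP => _ /imsetP[p pS ->]; rewrite finset.in_setX; apply/andP; split; apply: (imset_f (fun p : point => p _)).
rewrite cardsX leq_mul// spread// => p p' /SP[pA Fp] /SP[p'A Fp'].
  exact: (close p p' pA p'A Fp Fp').1.
rewrite (_ : (6 * e = 3 * e + 3 * e)%N); last by rewrite -mulnDl.
by rewrite natrD mulrDl; exact: (close p p' pA p'A Fp Fp').2.
Qed.

End Counting.

(** * Net content, discrete Frostman measures and capacitability *)

Section Net.
Context (R : realType) (X : Type) (I : choiceType) (q : nat -> X -> I)
  (g : nat -> R).
Hypothesis g_ge0 : forall n, 0 <= g n.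
Hypothesis q_nested : forall m n x y, (m <= n)%N -> q n x = q n y -> q m x = q m y.

Definition net_mass (U : set (nat * I)) : \bar R := (\esum_(Q in U) (g Q.1)%:E)%E.

Definition net_cover (U : set (nat * I)) (A : set X) : Prop :=
  forall x, A x -> exists n, U (n, q n x).

Definition net_content (A : set X) : \bar R :=
  ereal_inf [set net_mass U | U in [set U | net_cover U A]].

(** The maximal cubes of [U]. Since cubes are nested, all points of a cube give the same test; a
    label without points is kept. *)
Definition net_top (U : set (nat * I)) : set (nat * I) :=
  [set Q | U Q /\ forall x, q Q.1 x = Q.2 -> forall m, (m < Q.1)%N -> ~ U (m, q m x)].

Lemma net_massID (U V : set (nat * I)) :
  net_mass U = (net_mass (U `&` V) + net_mass (U `&` ~` V))%E.
Proof. by rewrite /net_mass (esumID V)// => i _; rewrite lee_fin. Qed.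

Lemma net_mass_ge0 (U : set (nat * I)) : (0 <= net_mass U)%E.
Proof. by apply: esum_ge0 => i _; rewrite lee_fin. Qed.

Lemma le_net_mass (U V : set (nat * I)) : U `<=` V -> (net_mass U <= net_mass V)%E.
Proof.
move=> UV; rewrite (net_massID V U) setIC (setIidl UV).
exact: leeDl (net_mass_ge0 _).
Qed.

Lemma net_massUI (U V : set (nat * I)) :
  (net_mass (U `|` V) + net_mass (U `&` V) = net_mass U + net_mass V)%E.
Proof.
rewrite (net_massID (U `|` V) U) setUK setIUl setICr set0U.
by rewrite -addeA; congr adde; rewrite (net_massID V U) addeC (setIC V U).
Qed.

Lemma net_massU_le (U V : set (nat * I)) :
  (net_mass (U `|` V) <= net_mass U + net_mass V)%E.
Proof. by rewrite -net_massUI leeDl// net_mass_ge0. Qed.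

Lemma net_content_ge0 (A : set X) : (0 <= net_content A)%E.
Proof. by apply: le_ereal_inf_tmp => _ [U _ <-]; exact: net_mass_ge0. Qed.

Lemma net_content_le (A : set X) U : net_cover U A -> (net_content A <= net_mass U)%E.
Proof. by move=> UA; apply: ereal_inf_lbound; exists U. Qed.

Lemma le_net_content (A B : set X) : A `<=` B -> (net_content A <= net_content B)%E.
Proof.
move=> AB; apply: le_ereal_inf_tmp => _ [U UB <-].
by apply: net_content_le => x /AB/UB.
Qed.

Lemma net_cover_top (U : set (nat * I)) (A : set X) :
  net_cover U A -> net_cover (net_top U) A.
Proof.
move=> UA x /UA [n Un].
have exn : exists n, `[< U (n, q n x) >] by exists n; apply/asboolP.
case: (ex_minnP exn) => k /asboolP Uk kmin; exists k; split => //= y yx m mk.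
rewrite (q_nested (ltnW mk) yx) => Um.
have /kmin : `[< U (m, q m x) >] by apply/asboolP.
by rewrite leqNgt mk.
Qed.

(* Strong subadditivity: the cubes of W and U that are not maximal, counted
   with multiplicity, still cover A. *)
Lemma net_mass_top (W U : set (nat * I)) (A : set X) :
  net_cover W A -> net_cover U A ->
  (net_mass (net_top (W `|` U)) + net_content A <= net_mass W + net_mass U)%E.
Proof.
move=> WA UA; rewrite -net_massUI (net_massID (W `|` U) (net_top (W `|` U))).
rewrite setIC setIidl; last by move=> Q [].
rewrite -addeA leeD2l// (le_trans _ (net_massU_le _ _))// net_content_le//.
move=> x Ax; have [m Wm] := WA x Ax; have [n Un] := UA x Ax.
have [mn|nm|mn] := ltngtP m n.
- by exists n; left; split; [right|move=> -[_ /(_ x erefl m mn)]; apply; left].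
- by exists m; left; split; [left|move=> -[_ /(_ x erefl n nm)]; apply; right].
- by exists m; right; split => //; rewrite mn.
Qed.

(** Nearly optimal covers [U n] of the [A n] are merged one after the other, keeping only maximal
    cubes. By strong subadditivity, step m + 1 increases the mass by at most c (m+1) - c m plus the
    error of [U m.+1], so only the errors e / 2^(n+1) accumulate. *)
Lemma net_content_bigcup (A : nat -> set X) (t : R) :
  (forall m n, (m <= n)%N -> A m `<=` A n) ->
  (forall n, (net_content (A n) <= t%:E)%E) ->
  (net_content (\bigcup_n A n) <= t%:E)%E.
Proof.
move=> Amono At; apply/lee_addgt0Pr => e e0.
have /choice[c cE] n : exists c, net_content (A n) = c%:E.
  exists (fine (net_content (A n))); rewrite fineK// ge0_fin_numE ?net_content_ge0//.
  by rewrite (le_lt_trans (At n))// ltry.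
have ct n : c n <= t by have := At n; rewrite cE lee_fin.
have /choice[U UP] n : exists U, net_cover U (A n) /\
    (net_mass U <= (c n + e / 2 ^+ n.+1)%:E)%E.
  have e1 : 0 < e / 2 ^+ n.+1 by rewrite divr_gt0// exprn_gt0.
  have [|_ [V VA <-] Vlt] := @lb_ereal_inf_adherent _ [set net_mass U | U in [set U | net_cover U (A n)]] _ e1.
    by rewrite -/(net_content _) cE.
  by exists V; split=> //; rewrite EFinD -cE ltW.
pose V m := [set Q | exists2 j, (j <= m)%N & U j Q].
have VA m : net_cover (V m) (A m).
  by move=> x Ax; have [n Un] := (UP m).1 x Ax; exists n, m.
have mV m : (net_mass (net_top (V m)) <= (c m + e * (1 - (2 ^+ m.+1)^-1))%:E)%E.
  elim: m => [|m IH].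
    apply: le_trans (le_trans (UP 0%N).2 _); last first.
      rewrite lee_fin lerD2l ler_pM2l// expr1.
      suff : (2^-1 : R) = 1 - 2^-1 by move=> <-.
      by field.
    by apply: le_net_mass => Q [[j]]; rewrite leqn0 => /eqP ->.
  have := @net_mass_top (net_top (V m)) (U m.+1) (A m)
    (net_cover_top (VA m)) (fun x Ax => (UP m.+1).1 x (Amono m m.+1 (leqnSn _) x Ax)).
  move=> /le_trans/(_ (leeD IH (UP m.+1).2)).
  rewrite cE -EFinD => top_le.
  have : (net_mass (net_top (V m.+1)) <= net_mass (net_top (net_top (V m) `|` U m.+1)))%E.
    apply: le_net_mass => Q [VQ Qtop]; split.
      move: VQ => [j]; rewrite leq_eqVlt ltnS => /orP[/eqP ->|jm Uj]; first by right.
      left; split; first by exists j.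
      by move=> x xQ n nQ [i im Ui]; apply: (Qtop x xQ n nQ); exists i => //; exact: leqW.
    move=> x xQ n nQ Un; apply: (Qtop x xQ n nQ); move: Un => [[[i im Ui] _]|Un].
      by exists i => //; exact: leqW.
    by exists m.+1.
  move=> /(leeD2r (c m)%:E) /le_trans /(_ top_le) {}top_le.
  have -> : (c m.+1 + e * (1 - (2 ^+ m.+2)^-1))%:E =
    ((c m + e * (1 - (2 ^+ m.+1)^-1) + (c m.+1 + e / 2 ^+ m.+2))%:E - (c m)%:E)%E.
    rewrite -EFinB; congr EFin; rewrite [in LHS]exprSr [in X in _ = _ + (_ + X) - _]exprSr.
    by field; rewrite expf_neq0.
  by rewrite leeBrDr.
apply: (@le_trans _ _ (net_mass (net_top [set Q | exists j, U j Q]))).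
  apply/net_content_le/net_cover_top => x [n _ Ax].
  by have [k Uk] := (UP n).1 x Ax; exists k, n.
apply: ge_ereal_sup => _ [F [Ffin FU] <-].
(* Finitely many maximal cubes of the whole union already occur in some [V m], where they are
   maximal as well; the bound on [net_top (V m)] thus passes to the sum over the union. *)
have [m Fm] : exists m, F `<=` V m.
  have /choice[j jP] : forall Q, exists j, F Q -> U j Q.
    move=> Q; have [/FU[[j Uj] _]|nF] := pselect (F Q); first by exists j.
    by exists 0%N.
  have [s sF] := (finite_seqP F).1 Ffin.
  exists (\max_(Q <- s) j Q) => Q FQ; exists (j Q); last exact: jP.
  by move: FQ; rewrite sF/= => Qs; rewrite (leq_bigmax_seq).
rewrite -esum_fset//; last by move=> i _; rewrite lee_fin.
apply: le_trans (le_trans (mV m) _).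
  apply: le_net_mass => Q FQ; split; first exact: Fm.
  by move=> x xQ n nQ [i _ Ui]; have := (FU Q FQ).2 x xQ n nQ; apply; exists i.
rewrite -EFinD lee_fin lerD// ler_piMr ?ltW// gerBl invr_ge0 exprn_ge0//.
Qed.

End Net.

Section Frostman.
Context (R : realType) (X : Type) (I : choiceType) (q : nat -> X -> I)
  (g : nat -> R) (J : finType) (x : J -> X).
Hypothesis g_ge0 : forall n, 0 <= g n.
Hypothesis q_nested : forall m n y z, (m <= n)%N -> q n y = q n z -> q m y = q m z.

Local Notation cube_mass w l Q := (\sum_(j | q l (x j) == Q) w j).

(* Greedy choice: the points are processed one after the other, each receiving
   the largest weight allowed, so that it ends up in a saturated cube. *)
Lemma saturated_weights (n : nat) (s : seq J) : exists w : J -> R,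
  [/\ forall j, 0 <= w j,
      forall l Q, (l <= n)%N -> cube_mass w l Q <= g l &
      forall j, j \in s ->
        exists2 l, (l <= n)%N & cube_mass w l (q l (x j)) = g l].
Proof.
elim: s => [|j s [w [w0 wg ws]]].
  by exists (fun=> 0); split => // l Q _; rewrite big1.
pose m (l : 'I_n.+1) := g l - cube_mass w l (q l (x j)).
pose l0 := [arg min_(l < ord0 | true) m l]%O.
have l0min l : m l0 <= m l.
  by rewrite /l0; case: arg_minP => // i _ /(_ l isT).
have m0 l : 0 <= m l by rewrite subr_ge0 wg// -ltnS.
pose w' k := w k + (if k == j then m l0 else 0).
have w'E l Q : cube_mass w' l Q =
    cube_mass w l Q + (if q l (x j) == Q then m l0 else 0).
  rewrite big_split/=; congr +%R; rewrite -big_mkcondr/=.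
  case: ifPn => jQ.
    rewrite (big_pred1 j)// => k /=; case: (eqVneq k j) => [->|]; rewrite ?andbF//.
    by rewrite jQ.
  rewrite big_pred0// => k /=; case: (eqVneq k j) => [->|]; rewrite ?andbF//.
  by rewrite (negPf jQ).
have w'g l Q : (l <= n)%N -> cube_mass w' l Q <= g l.
  move=> ln; rewrite w'E; case: ifPn => [/eqP <-|_]; last by rewrite addr0 wg.
  by rewrite -lerBrDl (l0min (Ordinal (ln : (l < n.+1)%N))).
exists w'; split => //.
  by move=> k; rewrite addr_ge0//; case: ifP.
move=> k; rewrite inE => /orP[/eqP ->|ks].
  by exists l0; [rewrite -ltnS|rewrite w'E eqxx /m addrC subrK].
have [l ln lk] := ws k ks; exists l => //; apply/le_anti; rewrite w'g//=.
by rewrite w'E lk lerDl; case: ifP.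
Qed.

(** In saturated weights, the coarsest saturated cubes containing the points [x j] are equal or
    disjoint, and they cover [K] because they have generation at most n. Their total mass is both
    the sum of the weights and a bound for the content, hence exceeds [t]; scaling down to mass [t]
    preserves the upper bounds. *)
Lemma discrete_frostman (n : nat) (K : set X) (t : R) : 0 < t ->
  (t%:E < net_content q g K)%E ->
  (forall y, K y -> exists j, q n (x j) = q n y) ->
  exists w : J -> R,
  [/\ forall j, 0 <= w j,
      forall l Q, (l <= n)%N -> cube_mass w l Q <= g l &
      \sum_j w j = t].
Proof.
move=> t0 tK Kx; have [w [w0 wg wsat]] := saturated_weights n (enum J).
have exl j : exists l, (l <= n)%N && (cube_mass w l (q l (x j)) == g l).
  have [|l ln lj] := wsat j; first by rewrite mem_enum.
  by exists l; rewrite ln lj eqxx.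
pose tau j := ex_minn (exl j).
have tauP j : (tau j <= n)%N /\ cube_mass w (tau j) (q (tau j) (x j)) = g (tau j).
  by rewrite /tau; case: ex_minnP => l /andP[ln /eqP].
have tau_min j l : (l <= n)%N -> cube_mass w l (q l (x j)) = g l -> (tau j <= l)%N.
  by move=> ln lj; rewrite /tau; case: ex_minnP => i _; apply; rewrite ln lj eqxx.
pose f j := (tau j, q (tau j) (x j)).
(* A point lying in the coarsest saturated cube of [j] has the same coarsest saturated cube:
   minimality of each of the two generations forces them to agree. *)
have fE j k : (q (tau j) (x k) == q (tau j) (x j)) = (f k == f j).
  apply/eqP/eqP => [qjk|[-> ->]//].
  have kj : (tau k <= tau j)%N.
    by apply: tau_min; [exact: (tauP j).1|rewrite qjk (tauP j).2].
  have jk : (tau j <= tau k)%N.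
    apply: tau_min; first exact: (tauP k).1.
    by rewrite -(q_nested kj qjk) (tauP k).2.
  by rewrite /f (@anti_leq (tau k) (tau j)) ?kj ?jk// qjk.
have tw : t < \sum_j w j.
  rewrite -lte_fin (lt_le_trans tK)//.
  pose U := undup [seq f j | j <- enum J].
  apply: (@le_trans _ _ (net_mass g [set` U])).
    apply: net_content_le => y /Kx[j jy]; exists (tau j).
    rewrite -(q_nested (tauP j).1 jy).
    by rewrite /= mem_undup; apply/mapP; exists j; rewrite ?mem_enum.
  rewrite /net_mass esum_fset//; [|exact: finite_seq|by move=> i _; rewrite lee_fin].
  rewrite -fsbig_seq ?undup_uniq//= sumEFin lee_fin.
  rewrite (eq_big_seq (fun Q => \sum_(j | f j == Q) w j)); last first.
    move=> Q; rewrite /U mem_undup => /mapP[j _ ->].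
    by rewrite -(tauP j).2; apply: eq_bigl => k; rewrite fE.
  rewrite (exchange_big_dep xpredT)//=; apply: ler_sum => j _.
  have fU : f j \in U by rewrite /U mem_undup map_f ?mem_enum.
  rewrite big_mkcond (bigD1_seq (f j))//= ?undup_uniq// eqxx big1 ?addr0// => Q.
  by rewrite eq_sym => /negPf ->.
have W0 : 0 < \sum_j w j := lt_trans t0 tw.
have c0 : 0 <= t / \sum_j w j by rewrite divr_ge0// ltW.
have c1 : t / \sum_j w j <= 1 by rewrite ler_pdivrMr// mul1r ltW.
exists (fun j => t / (\sum_j w j) * w j); split => [j|l Q ln|].
- by rewrite mulr_ge0.
- rewrite -mulr_sumr (le_trans _ (wg l Q ln))// ler_piMl// sumr_ge0//.
- by rewrite -mulr_sumr divfK ?gt_eqF.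
Qed.

End Frostman.

(** * Analytic sets and Choquet capacitability *)

Lemma infinite_path (P : seq nat -> Prop) : P [::] ->
  (forall s, P s -> exists a, P (rcons s a)) ->
  exists tau : nat -> nat, forall m, P (mkseq tau m).
Proof.
move=> P0 PS.
have /choice[f fP] : forall s, exists a, P s -> P (rcons s a).
  move=> s; have [/PS[a Pa]|nP] := pselect (P s); first by exists a.
  by exists 0%N.
pose sq := fix sq m := if m is m'.+1 then rcons (sq m') (f (sq m')) else [::].
exists (fun m => f (sq m)) => m.
have -> : mkseq (fun m => f (sq m)) m = sq m.
  by elim: m => // m IH; rewrite mkseqS IH.
by elim: m => //= m IH; exact: fP.
Qed.

(* F n s depends on the first n terms of s only: this is the Suslin operation
   over initial segments. *)
Definition analytic (T : topologicalType) (A : set T) :=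
  exists F : nat -> (nat -> nat) -> set T,
  [/\ forall n s, closed (F n s),
      forall n s u, (forall i, (i < n)%N -> s i = u i) -> F n s = F n u &
      A = [set x | exists s, forall n, F n s x]].

Lemma analytic_closed (T : topologicalType) (A : set T) : closed A -> analytic A.
Proof.
move=> cA; exists (fun _ _ => A); split => //.
by apply/seteqP; split => [x Ax|x [_ /(_ 0%N)]//]; exists id.
Qed.

Lemma analytic_bigcup (T : topologicalType) (A : nat -> set T) :
  (forall j, analytic (A j)) -> analytic (\bigcup_j A j).
Proof.
move=> /choice[F FP].
exists (fun n s => if n is m.+1 then F (s 0%N) m (fun i => s i.+1) else setT).
split.
- by move=> [|n] s; [exact: closedT|case: (FP (s 0%N))].
- move=> [//|n] s u su; rewrite su//; case: (FP (u 0%N)) => _ + _; apply => i ilt.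
  exact: su.
- apply/seteqP; split => x.
    move=> [j _]; case: (FP j) => _ _ -> [s sx].
    by exists (fun i => if i is i'.+1 then s i' else j) => -[].
  move=> [s sx]; exists (s 0%N) => //; case: (FP (s 0%N)) => _ _ ->.
  by exists (fun i => s i.+1) => n; exact: (sx n.+1).
Qed.

(** One sequence codes countably many, the j-th being read at the positions [pickle (j, i)]. To
    depend on n terms only, stage n imposes just those conditions [F j m] whose terms all have codes
    below n. *)
Lemma analytic_bigcap (T : topologicalType) (A : nat -> set T) :
  (forall j, analytic (A j)) -> analytic (\bigcap_j A j).
Proof.
move=> /choice[F FP].
pose sub (s : nat -> nat) (j i : nat) := s (pickle (j, i)).
exists (fun n s => [set x | forall j m, (forall i, (i < m)%N -> (pickle (j, i) < n)%N) ->
   F j m (sub s j) x]).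
split.
- move=> n s.
  have -> : [set x | forall j m, (forall i, (i < m)%N -> (pickle (j, i) < n)%N) ->
      F j m (sub s j) x] =
    \bigcap_(p in [set p : nat * nat | forall i, (i < p.2)%N -> (pickle (p.1, i) < n)%N])
      F p.1 p.2 (sub s p.1).
    apply/seteqP; split => x; first by move=> Fx [j m] /= /Fx.
    by move=> Fx j m jm; exact: (Fx (j, m)).
  by apply: closed_bigI => -[j m] _; case: (FP j).
- move=> n s u su.
  have FE j m : (forall i, (i < m)%N -> (pickle (j, i) < n)%N) ->
      F j m (sub s j) = F j m (sub u j).
    by move=> jm; case: (FP j) => _ + _; apply => i im; exact/su/jm.
  by apply/seteqP; split => x Fx j m jm; have := Fx j m jm; rewrite FE.
- apply/seteqP; split => x.
    move=> Ax.
    have /choice[s sP] j : exists s, forall n, F j n s x.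
      by have := Ax j I; case: (FP j) => _ _ ->.
    exists (fun k => if unpickle k is Some (j, i) then s j i else 0%N) => n j m _.
    suff -> : sub (fun k => if unpickle k is Some (j, i) then s j i else 0%N) j = s j.
      exact: sP.
    by apply/funext => i; rewrite /sub pickleK.
  move=> [s sx] j _; case: (FP j) => _ _ ->; exists (sub s j) => m.
  apply: (sx (\max_(i < m) pickle (j, nat_of_ord i)).+1) => i im.
  by rewrite ltnS (leq_bigmax (Ordinal im)).
Qed.

(** The sets that are analytic together with their complement form a sigma-algebra. It contains the
    open sets, each being the countable union of the closed sets of points whose ball of radius 1 /
    (n + 1) stays inside. *)
Lemma borel_analytic (R : realType) (d : nat) (A : set 'rV[R]_d.+1) :
  borel A -> analytic A.
Proof.
have open_analytic (U : set 'rV[R]_d.+1) : open U -> analytic U.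
  move=> oU; pose C n := [set x | forall y, ball x (n.+1%:R^-1 : R) y -> U y].
  have -> : U = \bigcup_n C n.
    apply/seteqP; split => x.
      move=> Ux; have /nbhs_ballP[e /= e0 eU] := open_nbhs_nbhs (conj oU Ux).
      have [n ne] : exists n : nat, n.+1%:R^-1 < e.
        exists (Num.truncn e^-1); rewrite invf_plt ?posrE ?truncnS_gt//.
      exists n => // y xy; apply: eU; exact: le_ball (ltW ne) _ xy.
    by move=> [n _ Cx]; apply: Cx; apply: ballxx; rewrite invr_gt0.
  apply: analytic_bigcup => n; apply: analytic_closed.
  have -> : C n = ~` (\bigcup_(y in ~` U) ball y (n.+1%:R^-1 : R)).
    apply/seteqP; split => x.
      by move=> Cx [y Uy yx]; apply: Uy; apply: Cx; exact: ball_sym.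
    by move=> nx y xy; apply: contrapT => Uy; apply: nx; exists y => //; exact: ball_sym.
  by apply: open_closedC; apply: bigcup_open => y _; exact: ball_open.
pose S := [set A : set 'rV[R]_d.+1 | analytic A /\ analytic (~` A)].
suff : (@borel R d.+1 `<=` S) by move=> /[apply] -[].
apply: smallest_sub; last first.
  by move=> U oU; split; [exact: open_analytic|apply/analytic_closed/open_closedC].
split.
- split; first exact/analytic_closed/closed0.
  by rewrite setC0; exact/analytic_closed/closedT.
- by move=> B [B1 B2]; rewrite setTD; split => //; rewrite setCK.
- move=> B BS; split; first by apply: analytic_bigcup => j; case: (BS j).
  by rewrite setC_bigcup; apply: analytic_bigcap => j; case: (BS j).
Qed.

(** Vanishing from [m] on selects one sequence for each bounded prefix of length [m]; with it the
    approximations of the capacitability theorem become finite unions of closed sets. *)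
Lemma finite_bounded_seqs (k : nat -> nat) (m : nat) :
  finite_set [set s : nat -> nat |
    forall i, (s i <= (if i < m then k i else 0))%N].
Proof.
elim: m => [|m IH].
  apply: (@sub_finite_set _ _ [set (fun=> 0%N)]) => [s /= s0|]; last exact: finite_set1.
  by apply/funext => i; apply/eqP; rewrite -leqn0.
pose ext (p : (nat -> nat) * nat) i := if i == m then p.2 else p.1 i.
apply: (@sub_finite_set _ _ (ext @` ([set s : nat -> nat |
    forall i, (s i <= (if i < m then k i else 0))%N] `*` `I_(k m).+1))).
  move=> s /= sk; exists (fun i => if i == m then 0%N else s i, s m).
    split => /=; last by have := sk m; rewrite ltnSn ltnS.
    by move=> i; have := sk i; rewrite ltnS (leq_eqVlt i m); case: eqP => [->|].
  by apply/funext => i; rewrite /ext /=; case: eqP => [->|].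
exact/finite_image/finite_setX/finite_II.
Qed.

Section Capacitability.
Context (R : realType) (T : topologicalType) (c : set T -> \bar R).
Hypothesis le_c : forall A B, A `<=` B -> (c A <= c B)%E.
Hypothesis c_bigcup : forall (A : nat -> set T) (t : R),
  (forall m n, (m <= n)%N -> A m `<=` A n) ->
  (forall n, (c (A n) <= t%:E)%E) -> (c (\bigcup_n A n) <= t%:E)%E.

(** The code of a point is bounded entry by entry: letting the bound on the next entry grow exhausts
    the current set, so continuity along increasing unions provides a bound [k m] keeping the
    capacity above [t]. [K m] retains only the first [m] steps of the bounded codes, which makes it
    closed but possibly larger than [E]. *)
Lemma capacitability (E : set T) (t : R) : analytic E -> (t%:E < c E)%E ->
  exists K : nat -> set T,
  [/\ forall n, closed (K n), forall m n, (m <= n)%N -> K n `<=` K m,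
      forall n, (t%:E < c (K n `&` E))%E & \bigcap_n K n `<=` E].
Proof.
move=> [F [Fcl Floc ->]] tE.
pose En (s : seq nat) := [set x | exists u,
  (forall i, (i < size s)%N -> (u i <= nth 0 s i)%N) /\ forall n, F n u x].
have [k kP] : exists k : nat -> nat, forall m, (t%:E < c (En (mkseq k m)))%E.
  apply: (@infinite_path (fun s => (t%:E < c (En s))%E)).
    by apply: lt_le_trans tE _; apply: le_c => x [u ux]; exists u.
  move=> s ts; apply: contrapT => nt; move: ts; apply/negP; rewrite -leNgt.
  have -> : En s = \bigcup_a En (rcons s a).
    apply/seteqP; split => x.
      move=> [u [us ux]]; exists (u (size s)) => //; exists u; split => // i.
      rewrite size_rcons ltnS leq_eqVlt nth_rcons => /orP[/eqP ->|il].
        by rewrite ltnn eqxx.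
      by rewrite il us.
    move=> [a _ [u [us ux]]]; exists u; split => // i il.
    by have := us i; rewrite size_rcons nth_rcons il; apply; exact: ltnW.
  apply: c_bigcup.
    move=> m n mn x [u [us ux]]; exists u; split => // i il.
    move: il; rewrite size_rcons => il.
    have := us i; rewrite size_rcons !nth_rcons => /(_ il); case: ifP => // _.
    by case: ifP => // _ /leq_trans; apply.
  by move=> a; rewrite leNgt; apply/negP => ta; apply: nt; exists a.
pose ok m u x := (forall i, (i < m)%N -> (u i <= k i)%N) /\
  forall n, (n <= m)%N -> F n u x.
have ok_le m n u x : (m <= n)%N -> ok n u x -> ok m u x.
  move=> mn [uk ux]; split => i im; first exact/uk/(leq_trans im).
  exact/ux/(leq_trans im).
exists (fun m => [set x | exists u, ok m u x]); split.
- move=> m; pose S := [set s : nat -> nat |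
    forall i, (s i <= (if i < m then k i else 0))%N].
  have -> : [set x | exists u, ok m u x] =
      \bigcup_(s in S) \bigcap_(n in `I_m.+1) F n s.
    apply/seteqP; split => x.
      move=> [u [uk ux]]; exists (fun i => if (i < m)%N then u i else 0%N).
        by move=> i /=; case: ifP => // /uk.
      move=> n /= nm; rewrite (Floc _ _ u); first exact: ux.
      by move=> i ilt; rewrite (leq_trans ilt).
    move=> [u uS ux]; exists u; split => // i im.
    by have := uS i; rewrite im.
  apply: closed_bigcup; first exact: finite_bounded_seqs.
  by move=> s _; apply: closed_bigI.
- by move=> m n mn x [u un]; exists u; exact: ok_le un.
- move=> m; apply: lt_le_trans (kP m) _; apply: le_c => x [u [uk ux]].
  split; last by exists u.
  exists u; split => // i im; have := uk i; rewrite size_mkseq nth_mkseq//.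
  exact.
- move=> x Kx.
  (* König's lemma: the prefixes bounded by [k] form a finitely branching tree, and [s] is a branch
     all of whose prefixes extend to admissible codes of every level. It is one full code of [x]. *)
  have [s sP] : exists s : nat -> nat, forall l, forall m, exists2 u, ok m u x &
      forall i, (i < l)%N -> u i = s i.
    have [s sP] : exists s : nat -> nat, forall l, forall m, exists2 u, ok m u x &
        forall i, (i < size (mkseq s l))%N -> u i = nth 0%N (mkseq s l) i.
      apply: (@infinite_path (fun v => forall m, exists2 u, ok m u x &
          forall i, (i < size v)%N -> u i = nth 0%N v i)).
        by move=> m; have [u um] := Kx m I; exists u.
      move=> v vP; apply: contrapT => /forallNP nv.
      have /choice[f fP] a : exists m, forall u, ok m u x ->
          ~ forall i, (i < size (rcons v a))%N -> u i = nth 0%N (rcons v a) i.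
        by have /existsNP[m mP] := nv a; exists m => u um uv; apply: mP; exists u.
      (* If every extension of [v] by one entry failed at some level, a code of a level beyond these
         finitely many failures would contradict its own next entry. *)
      pose M := maxn (size v).+1 (\max_(a < (k (size v)).+1) f a).
      have [u uM uv] := vP M.
      have ukv : (u (size v) < (k (size v)).+1)%N.
        by rewrite ltnS; case: uM => + _; apply; rewrite leq_max ltnSn.
      apply: (fP (u (size v)) u).
        apply: ok_le uM; rewrite leq_max; apply/orP; right.
        exact: (leq_bigmax (Ordinal ukv)).
      move=> i; rewrite size_rcons ltnS leq_eqVlt nth_rcons => /orP[/eqP ->|il].
        by rewrite ltnn eqxx.
      by rewrite il uv.
    exists s => l m; have [u um us] := sP l m; exists u => // i il.
    by rewrite us ?size_mkseq ?nth_mkseq.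
  exists s => n; have [u [_ ux] us] := sP n n.
  by rewrite -(Floc n u s us); exact: ux.
Qed.

End Capacitability.

(** * Energy of pairs in a common shell *)

Definition sq_dist (R : realType) (d : nat) (a x : 'rV[R]_d) : R :=
  \sum_l (x ord0 l - a ord0 l) ^+ 2.

Definition near_at (R : realType) (d : nat) (k : nat) (x y : 'rV[R]_d) : bool :=
  [forall i, `|x ord0 i - y ord0 i| <= 2 ^- k].

Section Energy.
Context (R : realType) (d' M n : nat) (L : R).
Hypothesis L_ge0 : 0 <= L.
Local Notation d := d'.+1.
Implicit Types (x y : 'rV[R]_d).
Local Notation point := {ffun 'I_d -> 'I_(grid M n).+1}.

Definition band (p : point) x y : bool :=
  `|sq_dist (corner R p) x - sq_dist (corner R p) y| <= L * 2 ^- n.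

(* Along the i-th direction the quantity compared in [band] is affine in the
   centre, with slope 2 (x i - y i). *)
Lemma card_band x y i (D : R) : 0 < D -> D <= `|x ord0 i - y ord0 i| ->
  #|[set p : point | band p x y]%SET|%:R <= (grid M n).+1%:R ^+ d' * (L / D + 1).
Proof.
move=> D0 Dxy; pose K := Num.truncn (L / D).
have LD0 : 0 <= L / D by rewrite divr_ge0// ltW.
apply: (@le_trans _ _ ((grid M n).+1 ^ d' * K.+1)%N%:R); last first.
  rewrite natrM natrX ler_wpM2l ?exprn_ge0// -natr1 lerD2r.
  by rewrite truncn_le.
rewrite ler_nat.
have -> : ((grid M n).+1 ^ d')%N = #|{: {ffun 'I_d' -> 'I_(grid M n).+1}}|.
  by rewrite card_ffun !card_ord.
apply: (@card_fibers _ _ _ (fun p : point => [ffun k => p (lift i k)])) => u.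
set S := [set _ in _ | _]%SET.
have SP p : p \in S -> band p x y /\ forall k, p (lift i k) = u k.
  rewrite !inE => /andP[pxy /eqP <-]; split => // k; by rewrite ffunE.
have inj_p : {in S &, injective (fun p : point => p i)}.
  move=> p p' /SP[_ pu] /SP[_ pu'] pi; apply/ffunP => l.
  by case: (unliftP i l) => [k ->|->//]; rewrite pu pu'.
rewrite -(card_in_imset inj_p); apply: card_spread => _ _ /imsetP[p pS ->] /imsetP[p' p'S ->].
have [[pb pu] [pb' pu']] := (SP p pS, SP p' p'S).
have [pp|pp] := leqP (p i) (p' i); first exact: leq_trans pp (leq_addr _ _).
rewrite -leq_subLR truncn_ge_nat// natrB ?(ltnW pp)// ler_pdivlMr//.
have h0 : 0 < 2 ^- n :> R by rewrite invr_gt0 exprn_gt0.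
have sE : (sq_dist (corner R p) x - sq_dist (corner R p) y) -
    (sq_dist (corner R p') x - sq_dist (corner R p') y) =
    - (2 * (((p i)%:R - (p' i)%:R) * (x ord0 i - y ord0 i))) * 2 ^- n.
  rewrite /sq_dist -!sumrB (bigD1 i)//= big1 ?addr0 => [|l li].
    by rewrite !mxE; ring.
  have [k lk|lk] := unliftP i l; last by rewrite lk eqxx in li.
  by rewrite lk !mxE pu pu'; ring.
have : `|- (2 * (((p i)%:R - (p' i)%:R) * (x ord0 i - y ord0 i))) * 2 ^- n| <= 2 * L * 2 ^- n.
  rewrite -sE (le_trans (ler_normB _ _))//.
  by move: pb pb'; rewrite /band => pb pb'; rewrite (_ : 2 * L * 2 ^- n = L * 2 ^- n + L * 2 ^- n) ?lerD//; ring.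
rewrite normrM normrN (gtr0_norm h0) ler_pM2r// !normrM ger0_norm// ler_pM2l//.
have pp0 : 0 <= (p i)%:R - (p' i)%:R :> R by rewrite subr_ge0 ler_nat ltnW.
rewrite ger0_norm// => /(le_trans _); apply.
by rewrite ler_wpM2l.
Qed.

(** Let l be the scale just before [x] and [y] first cease to be near. Some coordinate then differs
    by at least 2^-(l+1), and [card_band] gives, after normalization, a multiple of 2^l. If the
    points are still near at scale n, counting all cells gives 2^n. The sum on the right only
    dominates this single term, in a form that can be integrated over pairs. *)
Lemma card_band_scaled k x y : (k <= n)%N -> near_at k x y ->
  2 ^+ n * 2 ^- (n * d) * #|[set p : point | band p x y]%SET|%:R <=
  (2 * M%:R + 1) ^+ d * (2 * L + 1) * \sum_(k <= l < n.+1) 2 ^+ l * (near_at l x y)%:R.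
Proof.
move=> kn kxy; have C1 : 1 <= 2 * M%:R + 1 :> R by rewrite lerDr mulr_ge0.
have h0 m : 0 < 2 ^+ m :> R by rewrite exprn_gt0.
have b0 : 0 <= (2 * M%:R + 1) * 2 ^+ n :> R := le_trans (ler0n _ _) (grid_le R M n).
have card_le : #|[set p : point | band p x y]%SET|%:R <= ((2 * M%:R + 1) * 2 ^+ n) ^+ d :> R.
  apply: le_trans (_ : (grid M n).+1%:R ^+ d <= _).
    by rewrite -natrX ler_nat (leq_trans (max_card _))// card_ffun !card_ord.
  by rewrite lerXn2r ?nnegrE ?grid_le.
suff [l [kl ln lxy lle]] : exists l, [/\ (k <= l)%N, (l <= n)%N, near_at l x y &
    2 ^+ n * 2 ^- (n * d) * #|[set p : point | band p x y]%SET|%:R <=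
    (2 * M%:R + 1) ^+ d * (2 * L + 1) * 2 ^+ l].
  rewrite (le_trans lle)// ler_wpM2l//.
    by rewrite mulr_ge0 ?exprn_ge0 ?addr_ge0 ?mulr_ge0.
  rewrite (bigD1_seq l)/= ?iota_uniq//; last by rewrite mem_index_iota kl ltnS.
  by rewrite lxy mulr1 lerDl sumr_ge0// => i _; rewrite mulr_ge0 ?exprn_ge0.
have [nxy|nnxy] := boolP (near_at n x y).
  exists n; split => //; rewrite mulrC.
  apply: le_trans (_ : ((2 * M%:R + 1) * 2 ^+ n) ^+ d * (2 ^+ n * 2 ^- (n * d)) <= _).
    by rewrite ler_wpM2r// mulr_ge0// ?ltW// invr_gt0.
  have -> : ((2 * M%:R + 1) * 2 ^+ n) ^+ d * (2 ^+ n * 2 ^- (n * d)) =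
      (2 * M%:R + 1) ^+ d * 2 ^+ n :> R.
    by rewrite exprMn -exprM; field; rewrite gt_eqF.
  by rewrite ler_pM2r// ler_peMr ?exprn_ge0 ?(le_trans ler01)// lerDr mulr_ge0.
have [l [kl ln lxy l1xy]] : exists l, [/\ (k <= l)%N, (l < n)%N, near_at l x y & ~~ near_at l.+1 x y].
  have exm : exists m, (k <= m)%N && ~~ near_at m x y by exists n; rewrite kn.
  case: (ex_minnP exm) => m /andP[km mxy] mmin.
  have kltm : (k < m)%N.
    by rewrite ltn_neqAle km andbT; apply: contraNneq mxy => <-.
  exists m.-1; rewrite prednK ?(leq_ltn_trans _ kltm)//; split => //.
  - by rewrite -ltnS prednK ?(leq_ltn_trans _ kltm).
  - by rewrite mmin// kn.
  - apply/negPn/negP => m1; have /mmin : (k <= m.-1)%N && ~~ near_at m.-1 x y.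
      by rewrite m1 andbT -ltnS prednK ?(leq_ltn_trans _ kltm).
    by rewrite leqNgt ltn_predL (leq_ltn_trans _ kltm).
exists l; split => //; first exact: ltnW.
move: l1xy; rewrite negb_forall => /existsP[i]; rewrite -ltNge => /ltW xyi.
have l10 : 0 < 2 ^- l.+1 :> R by rewrite invr_gt0.
have := card_band l10 xyi; rewrite invrK => /(ler_wpM2l (_ : 0 <= 2 ^+ n * 2 ^- (n * d))).
rewrite mulr_ge0 ?invr_ge0 ?(ltW (h0 _))// => /(_ isT) card_le1.
apply: le_trans card_le1 _; apply: le_trans (_ : 2 ^+ n * 2 ^- (n * d) * (((2 * M%:R + 1) * 2 ^+ n) ^+ d' *
   (L * 2 ^+ l.+1 + 1)) <= _).
  rewrite ler_wpM2l ?mulr_ge0 ?invr_ge0 ?(ltW (h0 _))// ler_wpM2r//.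
    by rewrite addr_ge0// mulr_ge0// ltW.
  by rewrite lerXn2r ?nnegrE ?grid_le.
have -> : 2 ^+ n * 2 ^- (n * d) * (((2 * M%:R + 1) * 2 ^+ n) ^+ d' * (L * 2 ^+ l.+1 + 1)) =
    (2 * M%:R + 1) ^+ d' * (L * 2 ^+ l.+1 + 1) :> R.
  rewrite exprMn -exprM mulnS exprD; field.
  by rewrite !gt_eqF.
rewrite -mulrA; apply: ler_pM.
- by rewrite exprn_ge0// (le_trans ler01).
- by rewrite addr_ge0// mulr_ge0// ltW.
- by rewrite exprS ler_peMl// exprn_ge0// (le_trans ler01).
- rewrite exprS [leRHS]mulrDl mul1r (mulrCA L) mulrA lerD2l.
  by rewrite exprn_ege1// ler1n.
Qed.

End Energy.

Lemma geometric_tail_le (R : realType) (u : R) (k n : nat) : 0 <= u -> u < 1 ->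
  (k <= n)%N -> \sum_(k <= l < n) u ^+ l <= u ^+ k / (1 - u).
Proof.
move=> u0 u1 kn; rewrite ler_pdivlMr ?subr_gt0//.
suff -> : (\sum_(k <= l < n) u ^+ l) * (1 - u) = u ^+ k - u ^+ n.
  by rewrite gerBl exprn_ge0.
elim: n kn => [|n IH]; first by rewrite leqn0 => /eqP ->; rewrite big_geq// mul0r subrr.
rewrite leq_eqVlt => /orP[/eqP <-|kn]; first by rewrite big_geq// mul0r subrr.
by rewrite big_nat_recr//= mulrDl IH// exprSr; ring.
Qed.

Section DiscreteMeasure.
Context (R : realType) (d' n : nat) (J : finType) (x : J -> 'rV[R]_d'.+1)
  (w : J -> R) (z t : R).
Local Notation d := d'.+1.
Hypothesis w_ge0 : forall j, 0 <= w j.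
Hypothesis z_ge0 : 0 <= z.
Hypothesis w_sum : \sum_j w j = t.
Hypothesis w_cube : forall l (Q : 'rV[int]_d), (l <= n)%N ->
  \sum_(j | dyadic l (x j) == Q) w j <= z ^+ l.

(** A point near [y] at scale l has its dyadic indices within 1 of those of [y]; [phi] records the
    3^d possible offsets, shifted by 1 to be natural numbers. *)
Lemma near_mass (y : 'rV[R]_d) l : (l <= n)%N ->
  \sum_(j | near_at l y (x j)) w j <= 3 ^+ d * z ^+ l.
Proof.
move=> ln; pose fl (u : R) := Num.floor (2 ^+ l * u).
have flP j i : near_at l y (x j) ->
    (absz (fl (x j ord0 i) - fl (y ord0 i) + 1)%R < 3)%N /\
    absz (fl (x j ord0 i) - fl (y ord0 i) + 1)%R = fl (x j ord0 i) - fl (y ord0 i) + 1 :> int.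
  move=> /forallP/(_ i); have h0 : 0 < 2 ^+ l :> R by rewrite exprn_gt0.
  rewrite -(ler_pM2l h0) divff ?gt_eqF// -[X in X * _](gtr0_norm h0) -normrM.
  rewrite mulrBr ler_norml => /andP[].
  have := floor_itv (2 ^+ l * x j ord0 i); have := floor_itv (2 ^+ l * y ord0 i).
  rewrite -!/(fl _); set f := fl _; set g := fl _.
  rewrite !intrD => /andP[f1 f2] /andP[g1 g2] h1 h2.
  have g_lt : (g < f + 2)%R by rewrite -(ltr_int R) intrD; lra.
  have f_lt : (f < g + 2)%R by rewrite -(ltr_int R) intrD; lra.
  split; lia.
pose phi j : {ffun 'I_d -> 'I_3} :=
  [ffun i => inord (absz (fl (x j ord0 i) - fl (y ord0 i) + 1)%R)].
pose Q (p : {ffun 'I_d -> 'I_3}) : 'rV[int]_d :=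
  \row_i (fl (y ord0 i) + (p i)%:Z - 1).
rewrite (partition_big phi xpredT)//=.
apply: le_trans (_ : \sum_(p : {ffun 'I_d -> 'I_3}) z ^+ l <= _); last first.
  by rewrite sumr_const card_ffun !card_ord -natrX mulr_natl.
apply: ler_sum => p _; apply: le_trans (w_cube (Q p) ln).
rewrite [leLHS]big_mkcond [leRHS]big_mkcond; apply: ler_sum => j _.
case: ifP => [/andP[jn /eqP jp]|_]; last by case: ifP.
suff -> : dyadic l (x j) == Q p by [].
apply/eqP/rowP => i; rewrite !mxE -jp ffunE.
have [f3 fE] := flP j i jn; rewrite inordK// fE -/(fl _); lia.
Qed.

(** The quantity G_{n,k} with the centre moved to the corner of the cell [p]; the factor [L] in the
    width of the band absorbs this displacement. *)
Definition pair_energy (M : nat) (L : R) (k : nat) (p : {ffun 'I_d -> 'I_(grid M n).+1}) : R :=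
  \sum_i \sum_(j | near_at k (x i) (x j) && band L p (x i) (x j)) w i * w j.

(** Exchanging the sums leaves, for each pair, the number of cells in its band. The layer at scale l
    then contributes 2^l times a mass of order z^l, a geometric series that starts at k. *)
Lemma sum_pair_energy (M : nat) (L : R) k : 0 <= L -> (k <= n)%N -> 2 * z < 1 ->
  2 ^+ n * 2 ^- (n * d) * \sum_(p : {ffun 'I_d -> 'I_(grid M n).+1}) pair_energy L k p <=
  (2 * M%:R + 1) ^+ d * (2 * L + 1) * 3 ^+ d * t * ((2 * z) ^+ k / (1 - 2 * z)).
Proof.
move=> L0 kn z1; set C := (2 * M%:R + 1) ^+ d * (2 * L + 1).
have C0 : 0 <= C by rewrite mulr_ge0// ?exprn_ge0// addr_ge0// mulr_ge0.
have t0 : 0 <= t by rewrite -w_sum sumr_ge0.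
have -> : \sum_(p : {ffun 'I_d -> 'I_(grid M n).+1}) pair_energy L k p = \sum_i \sum_(j | near_at k (x i) (x j))
    w i * w j * #|[set p : {ffun 'I_d -> 'I_(grid M n).+1} | band L p (x i) (x j)]%SET|%:R.
  rewrite /pair_energy exchange_big; apply: eq_bigr => i _ /=.
  rewrite (exchange_big_dep (fun j => near_at k (x i) (x j)))/=; last by move=> p j _ /andP[].
  apply: eq_bigr => j nj; rewrite -sum1dep_card natr_sum mulr_sumr.
  by apply: eq_big => [p|p _]; rewrite ?nj ?mulr1.
rewrite mulr_sumr.
apply: le_trans (_ : \sum_i \sum_(j | near_at k (x i) (x j))
   w i * w j * (C * \sum_(k <= l < n.+1) 2 ^+ l * (near_at l (x i) (x j))%:R) <= _).
  apply: ler_sum => i _; rewrite mulr_sumr; apply: ler_sum => j nj.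
  by rewrite mulrCA ler_wpM2l ?mulr_ge0// card_band_scaled.
apply: le_trans (_ : \sum_i w i * (C * \sum_(k <= l < n.+1) 3 ^+ d * (2 * z) ^+ l) <= _).
  apply: ler_sum => i _; under eq_bigr do rewrite -mulrA.
  rewrite -[leLHS]mulr_sumr ler_wpM2l//; under eq_bigr do rewrite mulrCA.
  rewrite -[leLHS]mulr_sumr ler_wpM2l//; under eq_bigr do rewrite mulr_sumr.
  rewrite exchange_big/= big_nat_cond [leRHS]big_nat_cond; apply: ler_sum => l /andP[/andP[kl ln] _].
  under eq_bigr do rewrite mulrCA.
  rewrite -[leLHS]mulr_sumr exprMn [leRHS]mulrCA ler_wpM2l ?exprn_ge0//.
  rewrite (le_trans _ (near_mass (x i) ln))//.
  rewrite [leLHS]big_mkcond [leRHS]big_mkcond; apply: ler_sum => j _.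
  by case: (near_at l (x i) (x j)); case: (near_at k (x i) (x j)); rewrite ?mulr1 ?mulr0.
rewrite -mulr_suml w_sum -mulr_sumr mulrCA -!mulrA ler_wpM2l//.
rewrite ler_wpM2l ?addr_ge0 ?mulr_ge0// mulrCA ler_wpM2l ?exprn_ge0// ler_wpM2l// geometric_tail_le ?mulr_ge0//.
exact: leqW.
Qed.

End DiscreteMeasure.

(** * Radial shells *)

Lemma sum_sqr_le (R : realType) (V : finType) (A : {set V}) (f : V -> R) :
  (\sum_(v in A) f v) ^+ 2 <= #|A|%:R * \sum_(v in A) f v ^+ 2.
Proof.
have [->|[v0 v0A]] := set_0Vmem A; first by rewrite !big_set0 expr0n mulr0.
set s := \sum_(v in A) f v; set q := \sum_(v in A) f v ^+ 2; set m : R := #|A|%:R.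
have m0 : 0 < m by rewrite ltr0n (cardD1 v0) v0A.
have : 0 <= \sum_(v in A) (m * f v - s) ^+ 2 by apply: sumr_ge0 => v _; rewrite sqr_ge0.
have -> : \sum_(v in A) (m * f v - s) ^+ 2 = m * (m * q - s ^+ 2).
  transitivity (\sum_(v in A) (m ^+ 2 * f v ^+ 2 - 2 * m * s * f v + s ^+ 2)).
    by apply: eq_bigr => v _; ring.
  rewrite big_split sumrB/= -!mulr_sumr -/s -/q sumr_const -mulr_natr -/m; ring.
by rewrite pmulr_rge0// subr_ge0.
Qed.

(** Cauchy-Schwarz over the fibres of [phi]: the squared masses of the fibres add up to the mass of
    the pairs with equal image. *)
Lemma sqr_sum_image_le (R : realType) (J V : finType) (w : J -> R) (phi : J -> V)
    (A : {set J}) : (forall j, 0 <= w j) ->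
  (\sum_(j in A) w j) ^+ 2 <=
  #|[set phi j | j in A]%SET|%:R * \sum_i \sum_(j | phi j == phi i) w i * w j.
Proof.
move=> w0; rewrite (partition_big phi (mem [set phi j | j in A]%SET))/=; last first.
  by move=> j jA; rewrite imset_f.
apply: le_trans (sum_sqr_le _ _) _; rewrite ler_wpM2l//.
rewrite [leRHS](partition_big phi xpredT)//= [leLHS]big_mkcond/=.
apply: ler_sum => v _; case: ifP => _; last first.
  by apply: sumr_ge0 => i _; apply: sumr_ge0 => j _; rewrite mulr_ge0.
rewrite expr2 mulr_suml big_mkcond [leRHS]big_mkcond; apply: ler_sum => i _.
case: ifP => [/andP[_ /eqP iv]|_].
  rewrite iv eqxx mulr_sumr big_mkcond [leRHS]big_mkcond; apply: ler_sum => j _.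
  case: ifP => [/andP[_ /eqP ->]|_]; first by rewrite eqxx.
  by case: ifP => // _; rewrite mulr_ge0.
by case: ifP => // _; apply: sumr_ge0 => j _; rewrite mulr_ge0.
Qed.

Definition cells (R : realType) (d N k : nat) (Z : set 'rV[R]_d) :
    {set {ffun 'I_d -> 'I_(grid N k).+1}} :=
  [set p | `[< exists2 y, Z y & cell N k y = p >]]%SET.

Definition shell (R : realType) (d : nat) (a : 'rV[R]_d) (n s : nat) : set 'rV[R]_d :=
  [set y | Num.truncn (2 ^+ n * enorm (y - a)) = s].

Lemma sq_distE (R : realType) (d : nat) (a y : 'rV[R]_d) :
  sq_dist a y = enorm (y - a) ^+ 2.
Proof. by rewrite enorm_sqr; apply: eq_bigr => l _; rewrite !mxE. Qed.

Lemma truncn_dist (R : realType) (n : nat) (u v : R) : 0 <= u -> 0 <= v ->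
  Num.truncn (2 ^+ n * u) = Num.truncn (2 ^+ n * v) -> `|u - v| <= 2 ^- n.
Proof.
move=> u0 v0 uv; have h0 : 0 < 2 ^+ n :> R by rewrite exprn_gt0.
have := truncn_itv (mulr_ge0 (ltW h0) u0); have := truncn_itv (mulr_ge0 (ltW h0) v0).
rewrite uv; set k := Num.truncn _; rewrite -(natr1 k) => /andP[? ?] /andP[? ?].
rewrite -(ler_pM2l h0) divff ?gt_eqF// -[X in X * `|_|](gtr0_norm h0) -normrM mulrBr.
by rewrite ler_norml; apply/andP; split; lra.
Qed.

Lemma exp2N_small (R : realType) (e : R) : 0 < e -> exists n, 2 ^- n < e.
Proof.
move=> e0; exists (Num.truncn e^-1).
rewrite invf_plt ?posrE ?exprn_gt0//; apply: lt_le_trans (truncnS_gt _) _.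
by rewrite -natrX ler_nat ltn_expl.
Qed.

Section Slabs.
Context (R : realType) (d' n M N R1 : nat) (a : 'rV[R]_d'.+1).
Local Notation d := d'.+1.
Hypothesis aM : cube M a.
Implicit Types (x y : 'rV[R]_d).

(** In a common shell, squared distances to [a] differ by at most 2^-n times 2 R1. Replacing [a] by
    the corner of its cell changes this difference by at most 2 times 2^-n times 2N in each of the
    [d] coordinates. *)
Definition band_width : R := 2 * R1%:R + 4 * d%:R * N%:R.

Lemma shell_band x y s : cube N x -> cube N y ->
  enorm (x - a) <= R1%:R -> enorm (y - a) <= R1%:R ->
  shell a n s x -> shell a n s y -> band band_width (cell M n a) x y.
Proof.
move=> xN yN xR yR xs ys; rewrite /band; set b := corner R _.
have h0 : 0 < 2 ^+ n :> R by rewrite exprn_gt0.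
have sE : sq_dist b x - sq_dist b y = (sq_dist a x - sq_dist a y) -
    \sum_l 2 * (b ord0 l - a ord0 l) * (x ord0 l - y ord0 l).
  by rewrite /sq_dist -!sumrB; apply: eq_bigr => l _; ring.
rewrite sE (le_trans (ler_normB _ _))// mulrDl lerD//.
  rewrite !sq_distE subr_sqr normrM mulrC.
  set u := enorm (x - a) in xs xR *; set v := enorm (y - a) in ys yR *.
  have u0 : 0 <= u := enorm_ge0 _; have v0 : 0 <= v := enorm_ge0 _.
  have uv : `|u - v| <= 2 ^- n.
    by apply: truncn_dist => //; rewrite (xs : Num.truncn _ = s) (ys : Num.truncn _ = s).
  apply: ler_pM => //; rewrite ger0_norm ?addr_ge0//.
  by rewrite mulr_natl mulr2n lerD.
rewrite (le_trans (ler_norm_sum _ _ _))//.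
apply: le_trans (_ : \sum_(l < d) (4 * N%:R * 2 ^- n) <= _); last first.
  by rewrite sumr_const card_ord -[_ *+ d]mulr_natr; lra.
apply: ler_sum => l _; rewrite !normrM ger0_norm//.
have xy : `|x ord0 l - y ord0 l| <= N%:R + N%:R.
  by rewrite (le_trans (ler_normB _ _))// lerD.
have ba : `|b ord0 l - a ord0 l| <= 2 ^- n.
  by have := cell_itv n l aM; rewrite -/b ler_norml => /andP[? ?]; apply/andP; split; lra.
have -> : 4 * N%:R * 2 ^- n = 2 * 2 ^- n * (N%:R + N%:R) :> R by ring.
by apply: ler_pM => //; rewrite ?mulr_ge0// ler_pM2l.
Qed.

(** Points are classified by their shell and their cell of generation k. The points of the shells in
    [S] fill at most [#|S|] times [P] classes, and two points of one class are near at scale k and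
    lie in a common band. *)
Lemma shell_mass_le (J : finType) (x : J -> 'rV[R]_d) (w : J -> R) (K : set 'rV[R]_d)
    (S : {set 'I_(R1 * 2 ^ n).+1}) (k P : nat) :
  (forall j, 0 <= w j) -> (forall j, K (x j)) -> K `<=` cube N ->
  (forall y, K y -> enorm (y - a) <= R1%:R) ->
  (forall s, s \in S -> (#|cells N k (K `&` shell a n s)| <= P)%N) ->
  (\sum_(j | `[< exists2 s, s \in S & shell a n (nat_of_ord s) (x j) >]) w j) ^+ 2 <=
  #|S|%:R * P%:R * pair_energy x w band_width k (cell M n a).
Proof.
move=> w0 Kx KN KR SP.
pose rho j : 'I_(R1 * 2 ^ n).+1 := inord (Num.truncn (2 ^+ n * enorm (x j - a))).
have h0 : 0 < 2 ^+ n :> R by rewrite exprn_gt0.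
have rhoE j : shell a n (rho j) (x j).
  rewrite /shell/= inordK// ltnS truncn_le_nat.
  apply: (@le_lt_trans _ _ (R1 * 2 ^ n)%:R); last by rewrite ltr_nat.
  by rewrite natrM natrX mulrC ler_pM2r// KR.
pose A := [set j | rho j \in S]%SET.
have -> : \sum_(j | `[< exists2 s, s \in S & shell a n (nat_of_ord s) (x j) >]) w j =
    \sum_(j in A) w j.
  apply: eq_bigl => j; rewrite inE; apply/asboolP/idP => [[s sS js]|]; last by exists (rho j).
  suff -> : rho j = s by [].
  by apply/val_inj; rewrite /= -js -(rhoE j).
pose phi j := (rho j, cell N k (x j)).
apply: le_trans (sqr_sum_image_le phi A w0) _; apply: ler_pM => //.
- by apply: sumr_ge0 => i _; apply: sumr_ge0 => j _; rewrite mulr_ge0.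
- rewrite -natrM ler_nat -sum1_card (partition_big fst (mem S))/=; last first.
    by move=> _ /imsetP[j + ->]; rewrite inE.
  rewrite -sum_nat_const; apply: leq_sum => s sS.
  apply: leq_trans (SP s sS); rewrite sum1dep_card.
  have inj2 : {in [set v in [set phi j | j in A]%SET | v.1 == s]%SET &, injective snd}.
    by move=> [u1 u2] [v1 v2]; rewrite !inE/= => /andP[_ /eqP ->] /andP[_ /eqP ->] ->.
  rewrite -(card_in_imset inj2); apply: subset_leq_card; apply/fintype.subsetP => p.
  move=> /imsetP[v]; rewrite inE => /andP[/imsetP[j jA ->]] /= /eqP js ->.
  rewrite inE; apply/asboolP; exists (x j) => //; split; first exact: Kx.
  by rewrite -js; exact: rhoE.
- apply: ler_sum => i _; rewrite [leLHS]big_mkcond [leRHS]big_mkcond.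
  apply: ler_sum => j _; case: ifP => [/eqP[rij cij]|_]; last by case: ifP => // _; rewrite mulr_ge0.
  suff -> : near_at k (x i) (x j) && band band_width (cell M n a) (x i) (x j) by [].
  apply/andP; split.
    apply/forallP => l; apply: (@cell_dist _ _ N); [exact/KN/Kx|exact/KN/Kx|by rewrite cij].
  apply: (@shell_band _ _ (rho i)); [exact/KN/Kx|exact/KN/Kx|exact/KR/Kx|exact/KR/Kx| |].
    exact: rhoE.
  by rewrite -rij; exact: rhoE.
Qed.

End Slabs.

(** * Compactness: shells around undetermined spheres become thin *)

Lemma nested_compact (T : topologicalType) (A : set T) (C : nat -> set T) :
  compact A -> C 0%N `<=` A -> (forall n, closed (C n)) ->
  (forall m n, (m <= n)%N -> C n `<=` C m) -> (forall n, C n !=set0) ->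
  exists p, forall n, C n p.
Proof.
move=> cA C0A Ccl Cdec /choice[u uC].
have FA : (u @ \oo) A.
  by exists 0%N => // n _; apply: C0A; exact: Cdec (uC n).
have [p [_ pcl]] := cA (u @ \oo) _ FA.
exists p => n; apply: Ccl => B pB; apply: pcl => //.
by exists n => // m /= nm; exact: Cdec (uC m).
Qed.

Lemma truncn_nested (R : realType) (u v : R) (m n : nat) : 0 <= u -> 0 <= v ->
  (m <= n)%N -> Num.truncn (2 ^+ n * u) = Num.truncn (2 ^+ n * v) ->
  Num.truncn (2 ^+ m * u) = Num.truncn (2 ^+ m * v).
Proof.
move=> u0 v0; elim: n => [|n IH]; first by rewrite leqn0 => /eqP ->.
rewrite leq_eqVlt => /orP[/eqP -> //|mn uv]; apply: IH => //.
have p0 : 0 <= 2 ^+ n :> R by rewrite exprn_ge0.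
move: uv; rewrite !exprS -!mulrA.
move: (2 ^+ n * u) (2 ^+ n * v) (mulr_ge0 p0 u0) (mulr_ge0 p0 v0) => {}u {}v {}u0 {}v0 uv.
apply/esym/truncn_def; have /andP[] := truncn_itv u0; set k := Num.truncn u => k1 k2.
have : (k * 2 <= Num.truncn (2 * u))%N.
  by rewrite truncn_ge_nat ?mulr_ge0// natrM; lra.
have : (Num.truncn (2 * u) < k.+1 * 2)%N.
  by rewrite truncn_lt_nat ?mulr_ge0// natrM; lra.
rewrite uv truncn_lt_nat ?mulr_ge0// truncn_ge_nat ?mulr_ge0// !natrM => h1 h2.
by apply/andP; split; lra.
Qed.

Lemma continuous_sum (R : realType) (T : topologicalType) (I : Type) (r : seq I)
    (f : I -> T -> R) : (forall i, continuous (f i)) ->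
  continuous (fun x => \sum_(i <- r) f i x).
Proof.
move=> fc; elim: r => [|i r IH].
  by under eq_fun do rewrite big_nil; exact: cst_continuous.
under eq_fun do rewrite big_cons.
by move=> x; apply: cvgD; [exact: fc|exact: IH].
Qed.

Lemma continuous_enorm_sub (R : realType) (d : nat) (a : 'rV[R]_d) :
  continuous (fun x : 'rV[R]_d => enorm (x - a)).
Proof.
have -> : (fun x : 'rV[R]_d => enorm (x - a)) =
    (fun x => Num.sqrt (\sum_(i < d) (x ord0 i - a ord0 i) ^+ 2)).
  apply/funext => x; rewrite /enorm; congr Num.sqrt.
  by apply: eq_bigr => i _; rewrite !mxE.
move=> x; apply: (@continuous_comp _ _ _
  (fun x : 'rV[R]_d => \sum_(i < d) (x ord0 i - a ord0 i) ^+ 2) (@Num.sqrt R)); last first.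
  exact: sqrt_continuous.
apply: (@continuous_sum _ _ _ _
  (fun i (x : 'rV[R]_d) => (x ord0 i - a ord0 i) ^+ 2)) => i y.
apply: (@continuous_comp _ _ _ (fun x : 'rV[R]_d => x ord0 i - a ord0 i)
  (fun u => u ^+ 2)); last exact: exprn_continuous.
exact: (cvgB (@coord_continuous R 1 d ord0 i y) (cvg_cst (a ord0 i))).
Qed.

Lemma compact_cube (R : realType) (d N : nat) : compact (@cube R d N).
Proof.
have -> : @cube R d N = [set x : 'rV[R]_d | forall i, `[- N%:R, N%:R]%classic (x ord0 i)].
  by apply/seteqP; split => x xN i; have := xN i; rewrite /= in_itv/= ler_norml.
by apply: (@rV_compact R d (fun=> `[- N%:R, N%:R]%classic)) => _; exact: segment_compact.
Qed.

(** The bound of [card_near_circle], of order 2^(k(d-2)) since e = d - 2. *)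
Definition circle_cells (e N k : nat) : nat :=
  (e.+1 * 2 * (grid N k).+1 ^ e) * ((3 * e).+4 * (6 * e).+4).

Section Shells.
Context (R : realType) (e N : nat) (E : set 'rV[R]_e.+2) (K : nat -> set 'rV[R]_e.+2).
Hypothesis K_closed : forall n, closed (K n).
Hypothesis K_dec : forall m n, (m <= n)%N -> K n `<=` K m.
Hypothesis K_cube : K 0%N `<=` cube N.
Hypothesis K_E : \bigcap_n K n `<=` E.
Variables (a : 'rV[R]_e.+2) (k : nat).

Definition thin n s : Prop := (#|cells N k (K n `&` shell a n s)| <= circle_cells e N k)%N.

(** If every thin annulus around the sphere contained a point of [K n] at distance at least 2^-k
    from the set [Z] where the sphere meets the hyperplane of the slice, a limit point would be in
    [E], on the sphere and off that hyperplane. Hence some shell stays near [Z], and few cells meet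
    it. *)
Lemma thin_eventually (r : R) : 0 <= r -> ~ (0 < r /\ set_determines_sphere E a r) ->
  exists n, thin n (Num.truncn (2 ^+ n * r)).
Proof.
move=> r0 /undetermined_slice[v [c [v0 vc]]].
pose Z := [set z : 'rV[R]_e.+2 | \sum_l v ord0 l * z ord0 l = c /\ enorm (z - a) = r].
pose O := \bigcup_(z in Z) ball z (2 ^- k : R).
have O_open : open O by apply: bigcup_open => z _; exact: ball_open.
have O_near y : O y -> exists z, Z z /\ forall l, `|y ord0 l - z ord0 l| <= 2 ^- k.
  by move=> [z Zz zy]; exists z; split => // l; rewrite distrC ltW//; exact: zy.2 ord0 l.
(* The half-open shell is enlarged to a closed annulus, so that the sets are closed and
   decreasing. *)
pose C n := K n `&` [set y | `|enorm (y - a) - r| <= 2 ^- n] `&` ~` O.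
have [[n Cn]|nC] := pselect (exists n, C n = set0).
  exists n; rewrite /thin; apply: (@card_near_circle _ _ _ _ v a c (r ^+ 2)) => // p.
  rewrite inE => /asboolP[y [Ky ys] yp]; have yN : cube N y by exact/K_cube/(K_dec (leq0n n)).
  have [|z [[z1 z2] zy]] := O_near y.
    apply: contrapT => yO; have : C n y; last by rewrite Cn.
    by split => //; split => //=; exact: truncn_dist (enorm_ge0 _) r0 ys.
  by exists y, z; split => //; rewrite -z2 -sq_distE.
exfalso; have [|||||p pC] := @nested_compact _ (cube N) C.
- exact: compact_cube.
- by move=> y [[/K_cube]].
- move=> n; apply: closedI; last exact: open_closedC.
  apply: closedI; first exact: K_closed.
  apply: (@preimage_closed _ R (fun y : 'rV[R]_e.+2 => `|enorm (y - a) - r|) [set u : R | u <= 2 ^- n]).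
    move=> y _; apply: (@continuous_comp _ R R (fun y : 'rV[R]_e.+2 => enorm (y - a) - r)
      (fun u : R => `|u|)); last exact: norm_continuous.
    exact: (cvgB (@continuous_enorm_sub _ _ a y) (cvg_cst r)).
  exact: closed_le.
- move=> m n mn y [[Ky /= yr] yO]; split => //; split; first exact: K_dec mn _ Ky.
  by rewrite /= (le_trans yr)// lef_pV2 ?posrE ?exprn_gt0// ler_weXn2l// ler1n.
- by move=> n; apply/set0P/eqP => Cn; apply: nC; exists n.
have pE : E p by apply: K_E => n _; case: (pC n) => -[].
have pr : enorm (p - a) = r.
  apply/eqP; rewrite -subr_eq0 -normr_le0 leNgt; apply/negP => /exp2N_small[n].
  by rewrite ltNge; case: (pC n) => -[_ /= ->].
case: (pC 0%N) => _; apply; exists p; first by split => //; exact: vc.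
by apply: ballxx; rewrite invr_gt0 exprn_gt0.
Qed.

Lemma thin_nested (r : R) m n : 0 <= r -> (m <= n)%N ->
  thin m (Num.truncn (2 ^+ m * r)) -> thin n (Num.truncn (2 ^+ n * r)).
Proof.
move=> r0 mn; apply: leq_trans; apply: subset_leq_card; apply/fintype.subsetP => p.
rewrite inE => /asboolP[y [Ky ys] yp]; rewrite inE; apply/asboolP.
exists y => //; split.
  exact: K_dec mn _ Ky.
exact: truncn_nested (enorm_ge0 _) r0 mn ys.
Qed.

End Shells.

(* Dyadic intervals of the n-th generation are indexed by the naturals s, with
   s standing for [s / 2 ^ n, (s + 1) / 2 ^ n). *)
Lemma few_dyadic_intervals (R : realType) (bad : nat -> nat -> Prop) (T : set R) (m : nat) :
  (forall (r : R) k n, 0 <= r -> (k <= n)%N ->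
     bad n (Num.truncn (2 ^+ n * r)) -> bad k (Num.truncn (2 ^+ k * r))) ->
  (forall r : R, 0 <= r -> (forall n, bad n (Num.truncn (2 ^+ n * r))) -> T r) ->
  lebesgue_measure T = 0%E ->
  forall e : R, 0 < e -> exists n0, forall n, (n0 <= n)%N ->
    #|[set s : 'I_(m * 2 ^ n).+1 | `[< bad n s >]]%SET|%:R * 2 ^- n <= e.
Proof.
move=> bad_nested badT T0 e e0.
have p0 n : 0 < 2 ^+ n :> R by rewrite exprn_gt0.
pose D n s : set R := `[s%:R / 2 ^+ n, s.+1%:R / 2 ^+ n[%classic.
have DP n s (r : R) : D n s r <-> 0 <= r /\ Num.truncn (2 ^+ n * r) = s.
  rewrite /D/= in_itv/= ler_pdivrMr// ltr_pdivlMr// (mulrC r); split => [sr|[r0 <-]].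
    by split; [have := sr; rewrite -(pmulr_rge0 _ (p0 n)) => /andP[/(le_trans _)->]//|exact: truncn_def].
  by apply: truncn_itv; rewrite mulr_ge0// ltW.
have mD n s : measurable (D n s) by exact: measurable_itv.
have lD n s : lebesgue_measure (D n s) = (2 ^- n)%:E.
  rewrite /D lebesgue_measure_itv/= lte_fin ltr_pM2r ?invr_gt0// ltr_nat ltnSn.
  by rewrite -EFinB -(natr1 s) mulrDl mul1r addrAC subrr add0r.
(* The last index [m * 2 ^ n] stands for an interval starting at m, hence the window up to m + 1. *)
pose W : set R := `[0, m.+1%:R[%classic.
have mW : measurable W by exact: measurable_itv.
pose U n := W `&` \bigcup_(s in bad n) D n s.
have UP n (r : R) : U n r <-> W r /\ bad n (Num.truncn (2 ^+ n * r)).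
  split => [[Wr [s bs /DP[r0 rs]]]|[Wr br]]; first by rewrite rs.
  split => //; exists (Num.truncn (2 ^+ n * r)) => //; apply/DP; split => //.
  by move: Wr; rewrite /W/= in_itv/= => /andP[].
have mU n : measurable (U n).
  by apply: measurableI => //; apply: bigcup_measurable => s _.
have U_dec : {homo U : k n / (k <= n)%N >-> (n <= k)%O}.
  move=> k n kn; apply/subsetPset => r /UP[Wr br]; apply/UP; split => //.
  by apply: bad_nested br => //; move: Wr; rewrite /W/= in_itv/= => /andP[].
(* [T] may fail to be measurable; it is reached only through monotonicity of the outer measure,
   whereas the continuity argument concerns the measurable sets [U n]. *)
have capU : lebesgue_measure (\bigcap_n U n) = 0%E.
  apply/le_anti; rewrite measure_ge0 andbT -T0; apply: le_mu_ext => r Ur.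
  have [Wr _] := (UP 0%N r).1 (Ur 0%N I).
  by apply: badT => [|n]; [move: Wr; rewrite /W/= in_itv/= => /andP[]|case/UP: (Ur n I)].
have Ufin : (lebesgue_measure (U 0%N) < +oo)%E.
  apply: le_lt_trans (_ : lebesgue_measure W < _)%E.
    by apply: le_mu_ext; exact: subIsetl.
  by rewrite /W lebesgue_measure_itv/= lte_fin ltr0n -EFinB ltry.
have cvU : lebesgue_measure (U n) @[n --> \oo] --> (0%E : \bar R).
  by rewrite -capU; exact: nonincreasing_cvg_mu Ufin mU (bigcapT_measurable mU) U_dec.
move: cvU => /fine_cvgP[_ /cvgrPdist_le/(_ e e0)[n0 _ n0P]].
exists n0 => n /n0P; rewrite /= sub0r normrN => /(le_trans (ler_norm _)); apply: le_trans.
rewrite -lee_fin fineK; last first.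
  rewrite ge0_fin_numE// (le_lt_trans _ Ufin)//; apply: le_mu_ext.
  exact/subsetPset/U_dec.
set A := [set _ | _]%SET.
apply: (@le_trans _ _ (lebesgue_measure (\big[setU/set0]_(s < (m * 2 ^ n).+1 | s \in A) D n s))).
  rewrite measure_bigsetU_ord; [|by move=> s; exact: mD|]; last first.
    apply/trivIsetP => s s' _ _ ss'; apply/seteqP; split => // r [/DP[_ rs] /DP[_ rs']].
    by move: ss'; rewrite -val_eqE /= -rs rs' eqxx.
  rewrite (eq_bigr (fun=> (2 ^- n)%:E)) => [|s _]; last exact: lD.
  rewrite sumEFin sumr_const mulr_natl.
  by rewrite lexx.
apply: le_mu_ext; apply: (big_ind (fun B => B `<=` U n)) => // [B B'|s sA r Ds].
  by rewrite subUset.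
have [r0 rs] := (DP n s r).1 Ds; apply/UP; split; last first.
  by rewrite rs; move: sA; rewrite inE => /asboolP.
rewrite /W/= in_itv/= r0/=; have := truncn_itv (mulr_ge0 (ltW (p0 n)) r0).
rewrite rs => /andP[_ /lt_le_trans rlt]; rewrite -(ltr_pM2l (p0 n)) rlt//.
rewrite mulrC -natrX -natrM ler_nat (leq_trans (ltn_ord s))// mulSn.
by rewrite -add1n leq_add2r expn_gt0.
Qed.

(** * Lebesgue outer measure *)

(** Passes between covers indexed by a countable type and the sequences in the definitions of the
    measures; numbers that code nothing contribute 0. *)
Lemma nneseries_pickle (R : realType) (T : countType) (v : T -> \bar R) :
  (forall p, (0 <= v p)%E) ->
  (\sum_(0 <= k <oo) oapp v 0%E (pickle_inv k) = \esum_(p in [set: T]) v p)%E.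
Proof.
move=> v0; have f0 k : (0 <= oapp v 0 (pickle_inv k))%E by case: pickle_inv.
rewrite nneseries_esumT// (esumID (range (@pickle T)))// setTI [X in (_ + X)%E]esum1 => [|k].
  rewrite adde0 esum_image => [|p q _ _]; last by move=> pq; apply: (pcan_inj (@pickleK T)).
  by apply: eq_esum => p _; rewrite pickleK_inv.
move=> [_ kr]; have := @pickle_invK T k; case: (pickle_inv k) => //= p pk.
by exfalso; apply: kr; exists p.
Qed.

Section LebesgueOuter.
Context (R : realType) (d' : nat).
Local Notation d := d'.+1.
Local Notation mu := (@lebesgue_outer_measure R d).
Implicit Types (A : set 'rV[R]_d) (p : 'rV[R]_d * 'rV[R]_d).

Lemma box_volume_ge0 p : 0 <= box_volume p.
Proof. by apply: prodr_ge0 => i _; rewrite le_max lexx. Qed.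

(** The padding box of covers. Positive dimension matters here, as the empty product is 1. *)
Lemma box_volume0 : box_volume (0 : 'rV[R]_d, 0 : 'rV[R]_d) = 0.
Proof. by rewrite /box_volume big_ord_recl/= !mxE subrr maxxx mul0r. Qed.

Lemma lebesgue_outer_le A (B : nat -> 'rV[R]_d * 'rV[R]_d) :
  A `<=` \bigcup_k box (B k) -> (mu A <= \sum_(0 <= k <oo) (box_volume (B k))%:E)%E.
Proof. by move=> AB; apply: ereal_inf_lbound; exists B. Qed.

Lemma lebesgue_outer_ge0 A : (0 <= mu A)%E.
Proof.
apply: le_ereal_inf_tmp => _ [B _ <-]; apply: nneseries_ge0 => k _ _.
by rewrite lee_fin box_volume_ge0.
Qed.

Lemma lebesgue_outer_box A p : A `<=` box p -> (mu A <= (box_volume p)%:E)%E.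
Proof.
move=> Ap; apply: le_trans (lebesgue_outer_le (B := fun k => if k is 0%N then p else (0, 0)) _) _.
  by move=> x /Ap xp; exists 0%N.
rewrite nneseries_recl// => [|k _]; last by rewrite lee_fin box_volume_ge0.
rewrite eseries0 ?adde0// => -[//|k] _ _; by rewrite box_volume0.
Qed.

Lemma lebesgue_outer0 : mu set0 = 0%E.
Proof.
apply/le_anti; rewrite lebesgue_outer_ge0 andbT.
by apply: le_trans (lebesgue_outer_box (p := (0, 0)) _) _ => //; rewrite box_volume0.
Qed.

Lemma le_lebesgue_outer : {homo mu : A B / A `<=` B >-> (A <= B)%E}.
Proof.
move=> A B AB; apply: ereal_inf_le_tmp => _ [C BC <-]; exists C => //.
exact: subset_trans BC.
Qed.

Lemma lebesgue_outer_sigma_subadditive : sigma_subadditive mu.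
Proof.
move=> A; have [[i ioo]|] := pselect (exists i, mu (A i) = +oo%E).
  rewrite (eseries_pinfty _ _ ioo) ?leey// => n _.
  by rewrite -ltNye (lt_le_trans _ (lebesgue_outer_ge0 _)).
move=> /forallNP Afin; apply/lee_addgt0Pr => e e0.
rewrite (le_trans _ (epsilon_trick xpredT (fun i => lebesgue_outer_ge0 (A i)) (ltW e0)))//.
have /choice[B BP] n : exists B, A n `<=` \bigcup_k box (B k) /\
    (\sum_(0 <= k <oo) (box_volume (B k))%:E <= mu (A n) + (e / (2 ^ n.+1)%:R)%:E)%E.
  have en : 0 < e / (2 ^ n.+1)%:R by rewrite divr_gt0// ltr0n expn_gt0.
  have mfin : mu (A n) \is a fin_num.
    by rewrite ge0_fin_numE ?lebesgue_outer_ge0// ltey; apply/eqP.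
  by have [_ [B AB <-] Blt] := lb_ereal_inf_adherent en mfin; exists B; split => //; exact: ltW.
pose C k := oapp (fun q : nat * nat => B q.1 q.2) (0, 0) (pickle_inv k).
apply: le_trans (lebesgue_outer_le (B := C) _) _.
  move=> x [n _ /(BP n).1[k _ xk]]; exists (pickle (n, k)) => //.
  by rewrite /C pickleK_inv.
have -> : (\sum_(0 <= k <oo) (box_volume (C k))%:E = \sum_(0 <= k <oo)
    oapp (fun q => (box_volume (B q.1 q.2))%:E) 0 (pickle_inv k))%E.
  by apply: eq_eseriesr => k _; rewrite /C; case: pickle_inv => //=; rewrite box_volume0.
rewrite nneseries_pickle; last by move=> q; rewrite lee_fin box_volume_ge0.
rewrite -[X in esum X _](_ : [set: nat] `*`` (fun=> [set: nat]) = _); last first.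
  by apply/seteqP; split.
rewrite -(@esum_esum _ _ _ setT (fun=> setT) (fun n k => (box_volume (B n k))%:E)); last first.
  by move=> n k _ _; rewrite lee_fin box_volume_ge0.
rewrite -nneseries_esumT; last by move=> n; apply: esum_ge0 => k _; rewrite lee_fin box_volume_ge0.
apply: lee_nneseries => [n _ _|n _]; first by apply: esum_ge0 => k _; rewrite lee_fin box_volume_ge0.
rewrite -nneseries_esumT; last by move=> k; rewrite lee_fin box_volume_ge0.
exact: (BP n).2.
Qed.

HB.instance Definition _ := isOuterMeasure.Build R 'rV[R]_d mu lebesgue_outer0
  lebesgue_outer_ge0 le_lebesgue_outer lebesgue_outer_sigma_subadditive.

(* A hyperplane x i = c cuts every box into two boxes of the same total volume. *)
Lemma caratheodory_halfspace (i : 'I_d) (c : R) :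
  caratheodory_measurable mu [set x | x ord0 i < c].
Proof.
pose set_i (x : 'rV[R]_d) u : 'rV[R]_d := \row_l if l == i then u else x ord0 l.
pose lo p := (p.1, set_i p.2 (Num.min (p.2 ord0 i) c)).
pose hi p := (set_i p.1 (Num.max (p.1 ord0 i) c), p.2).
have vol p : box_volume (lo p) + box_volume (hi p) = box_volume p.
  rewrite /box_volume (bigD1 i)//= [X in _ + X = _](bigD1 i)//= [RHS](bigD1 i)//= !mxE eqxx.
  rewrite (eq_bigr (fun l => Num.max 0 (p.2 ord0 l - p.1 ord0 l))); last first.
    by move=> l /negPf li; rewrite !mxE li.
  rewrite [X in _ + _ * X](eq_bigr (fun l => Num.max 0 (p.2 ord0 l - p.1 ord0 l))); last first.
    by move=> l /negPf li; rewrite !mxE li.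
  rewrite -mulrDl; congr *%R.
  move: (p.1 ord0 i) (p.2 ord0 i) => u v.
  rewrite /Num.max /Num.min; case: (ltP v c) => ?; case: (ltP u c) => ?; repeat case: ltP => ?; lra.
apply: le_caratheodory_measurable => X.
apply: le_ereal_inf_tmp => _ [B XB <-].
have -> : (\sum_(0 <= k <oo) (box_volume (B k))%:E =
    \sum_(0 <= k <oo) (box_volume (lo (B k)))%:E + \sum_(0 <= k <oo) (box_volume (hi (B k)))%:E)%E.
  rewrite -nneseriesD; last 2 first.
  - by move=> k _ _; rewrite lee_fin box_volume_ge0.
  - by move=> k _ _; rewrite lee_fin box_volume_ge0.
  by apply: eq_eseriesr => k _; rewrite -EFinD vol.
apply: leeD; apply: lebesgue_outer_le => x [/XB[k _ xk]] /= xc; exists k => // l;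
  have /andP[x1 x2] := xk l; rewrite /= ?mxE ?x1 ?x2 ?andbT//=.
  by case: eqP => [->|//]; rewrite le_min; case/andP: (xk i) => _ ->; rewrite /= ltW.
by case: eqP => [->|//]; rewrite ge_max; case/andP: (xk i) => -> _; move/negP: xc; rewrite -leNgt.
Qed.

End LebesgueOuter.

(** Fatou's lemma for sets: the intersections of the tails increase, and each lies in some [A n]
    with n >= k. Continuity from below is what requires the [A n] to be Carathéodory measurable. *)
Lemma outer_measure_liminf (R : realType) (T : pointedType)
    (mu : {outer_measure set T -> \bar R}) (A : nat -> set T) (k : nat) (eta : R) :
  (forall n, caratheodory_measurable mu (A n)) ->
  (forall n, (k <= n)%N -> (mu (A n) <= eta%:E)%E) ->
  (mu [set x | exists n0, forall n, (n0 <= n)%N -> A n x] <= eta%:E)%E.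
Proof.
move=> mA Aeta; pose D n0 := \bigcap_(n in [set n | (n0 <= n)%N]) A n.
have mD n0 : mu.-cara.-measurable (D n0) by apply: bigcap_measurable => [|n _]; [exists n0 => /=|exact: mA].
have -> : [set x | exists n0, forall n, (n0 <= n)%N -> A n x] = \bigcup_n D n.
  by apply/seteqP; split => x [n0 xn0]; exists n0.
have cvD : mu (D n) @[n --> \oo] --> mu (\bigcup_n D n).
  apply: (@nondecreasing_cvg_mu _ (caratheodory_type mu) R mu D) => //.
    exact: bigcupT_measurable.
  move=> m n mn; apply/subsetPset => x Dx l /= nl; apply: Dx => /=; exact: leq_trans nl.
apply: (cvge_le _ cvD); exists k => // n /= kn.
rewrite (le_trans _ (Aeta n kn))//; apply: le_outer_measure => x; apply; exact: leqnn.
Qed.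

Lemma outer_measure_bigcup0 (R : realType) (T : Type)
    (mu : {outer_measure set T -> \bar R}) (A : nat -> set T) :
  (forall n, mu (A n) = 0%E) -> mu (\bigcup_n A n) = 0%E.
Proof.
move=> A0; apply/le_anti; rewrite outer_measure_ge0 andbT.
apply: le_trans (outer_measure_sigma_subadditive mu A) _.
by rewrite eseries0// => n _ _; exact: A0.
Qed.

Section CellUnions.
Context (R : realType) (d' M n : nat).
Local Notation d := d'.+1.
Local Notation mu := (@lebesgue_outer_measure R d).
Local Notation point := {ffun 'I_d -> 'I_(grid M n).+1}.

Definition half_open_cell (p : point) : set 'rV[R]_d :=
  [set x | forall i, corner R p ord0 i <= x ord0 i < corner R p ord0 i + 2 ^- n].

Definition cell_union (P : {set point}) : set 'rV[R]_d :=
  \bigcup_(p in [set` P]) half_open_cell p.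

Lemma cell_unionP (P : {set point}) x : cube M x -> cell M n x \in P -> cell_union P x.
Proof. by move=> xM xP; exists (cell M n x) => // i; exact: cell_itv. Qed.

Lemma caratheodory_cell_union (P : {set point}) : caratheodory_measurable mu (cell_union P).
Proof.
pose H i c : set (caratheodory_type mu) := [set x : 'rV[R]_d | x ord0 i < c].
have mH i c : measurable (H i c) by exact: caratheodory_halfspace.
have mQ p : measurable (half_open_cell p : set (caratheodory_type mu)).
  have -> : half_open_cell p = \bigcap_(i in [set: 'I_d])
      (~` H i (corner R p ord0 i) `&` H i (corner R p ord0 i + 2 ^- n)).
    apply/seteqP; split => x.
      by move=> xp i _; have /andP[x1 x2] := xp i; split => //; apply/negP; rewrite -leNgt.
    by move=> xp i; have [/negP] := xp i I; rewrite -leNgt => -> ->.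
  apply: fin_bigcap_measurable; first exact: finite_finset.
  by move=> i _; apply: measurableI => //; exact: measurableC.
apply: (@fin_bigcup_measurable _ (caratheodory_type mu)) => [|p _]; first exact: finite_finset.
exact: mQ.
Qed.

Lemma cell_union_le (P : {set point}) :
  (mu (cell_union P) <= (#|P|%:R * 2 ^- (n * d))%:E)%E.
Proof.
have cell_le p : (mu (half_open_cell p) <= (2 ^- (n * d))%:E)%E.
  pose b : 'rV[R]_d := \row_i (corner R p ord0 i + 2 ^- n).
  apply: le_trans (lebesgue_outer_box (p := (corner R p, b)) _) _.
    by move=> x xp i; have /andP[x1 /ltW x2] := xp i; rewrite x1 /b mxE.
  rewrite lee_fin /box_volume (eq_bigr (fun=> 2 ^- n)) => [|i _].
    by rewrite prodr_const card_ord exprVn -exprM.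
  by rewrite /b /= [X in X - _]mxE addrAC subrr add0r max_r// invr_ge0 exprn_ge0.
have -> : cell_union P = \bigcup_(p in [set` enum P]) half_open_cell p.
  by apply: eq_bigcupl; split => p /=; rewrite mem_enum.
rewrite cardE; elim: (enum P) => [|p s IH].
  by rewrite set_nil bigcup_set0 outer_measure0 mul0r.
have -> : [set` p :: s] = p |` [set` s].
  by apply/seteqP; split => q /=; rewrite inE => /predU1P.
rewrite bigcup_setU1 (le_trans (outer_measureU2 _ _ _))//.
by rewrite /= -(natr1 (size s)) addrC mulrDl mul1r EFinD leeD.
Qed.

End CellUnions.

(** * Hausdorff dimension and net content *)

Lemma powR2_gt1 (R : realType) (u : R) : 0 < u -> 1 < (2 : R) `^ u.
Proof.
by move=> u0; have := @gt0_ltr_powR R u u0 1 2; rewrite powR1 !nnegrE; apply; rewrite // ltr1n.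
Qed.

Section HausdorffContent.
Context (R : realType) (d' : nat).
Local Notation d := d'.+1.
Implicit Types (E U : set 'rV[R]_d) (s z : R).

Lemma ediam_le U (c : R) : (forall x y, U x -> U y -> enorm (x - y) <= c) ->
  (ediam U <= c%:E)%E.
Proof.
by move=> Uc; apply: ge_ereal_sup => _ [[x y] [/= Ux Uy] <-]; rewrite lee_fin Uc.
Qed.

Lemma hausdorff_gauge_ge0 s U : (0 <= hausdorff_gauge s U)%E.
Proof. by rewrite /hausdorff_gauge; case: ifP => // _; exact: poweR_ge0. Qed.

Lemma hausdorff_gauge_le s U (c : R) : 0 <= s -> 0 <= c ->
  (ediam U <= c%:E)%E -> (hausdorff_gauge s U <= (c `^ s)%:E)%E.
Proof.
move=> s0 c0 Uc; rewrite /hausdorff_gauge; case: ifPn => [_|/set0P[x Ux]].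
  by rewrite lee_fin powR_ge0.
rewrite -poweR_EFin; apply: gt0_ler_poweR => //; rewrite in_itv/= leey andbT//.
apply: le_trans (_ : (enorm (x - x))%:E <= _)%E; first by rewrite lee_fin enorm_ge0.
by apply: ereal_sup_ubound; exists (x, x).
Qed.

Lemma hausdorff_measure_eq0 s E :
  (forall delta e : R, 0 < delta -> 0 < e -> (hausdorff_content s delta E <= e%:E)%E) ->
  hausdorff_measure s E = 0%E.
Proof.
move=> Ee; apply/le_anti/andP; split.
  apply: ge_ereal_sup => _ [delta /= delta0 <-]; apply/lee_addgt0Pr => e e0.
  by rewrite add0e; exact: Ee.
apply: (@le_trans _ _ (hausdorff_content s 1 E)).
  apply: le_ereal_inf_tmp => _ [U _ <-]; apply: nneseries_ge0 => k _ _.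
  exact: hausdorff_gauge_ge0.
by apply: ereal_sup_ubound; exists 1 => //=; exact: ltr01.
Qed.

Lemma dyadic_enorm_le n (x y : 'rV[R]_d) : dyadic n x = dyadic n y ->
  enorm (x - y) <= d%:R * 2 ^- n.
Proof.
move=> xy; have h0 : 0 < 2 ^+ n :> R by rewrite exprn_gt0.
have xyi i : `|x ord0 i - y ord0 i| <= 2 ^- n.
  rewrite -(ler_pM2l h0) divff ?gt_eqF// -[X in X * `|_|](gtr0_norm h0) -normrM mulrBr.
  have := congr1 (fun Q : 'rV[int]_d => Q ord0 i) xy; rewrite !mxE => fE.
  have := floor_itv (2 ^+ n * x ord0 i); have := floor_itv (2 ^+ n * y ord0 i).
  rewrite fE intrD => /andP[? ?] /andP[? ?].
  by rewrite ler_norml; apply/andP; split; lra.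
have dn0 : 0 <= d%:R * 2 ^- n :> R by rewrite mulr_ge0// invr_ge0 ltW.
rewrite -(@ler_pXn2r _ 2) ?nnegrE ?enorm_ge0// enorm_sqr.
apply: le_trans (_ : \sum_(i < d) (2 ^- n) ^+ 2 <= _).
  apply: ler_sum => i _; rewrite !mxE -[X in X <= _]real_normK ?num_real//.
  by rewrite ler_pXn2r ?nnegrE// invr_ge0 ltW.
rewrite sumr_const card_ord -[X in X <= _]mulr_natl exprMn ler_wpM2r ?exprn_ge0 ?invr_ge0 ?(ltW h0)//.
by rewrite expr2 ler_peMl// ler1n.
Qed.

(** A cover of small net mass consists of fine cubes only, since a single coarse cube would weigh
    too much. It is thus admissible for any given [delta], at a cost of at most d^s times its net
    mass. *)
Lemma net_content_gt0 s E : 0 < s -> hausdorff_measure s E <> 0%E ->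
  (0 < net_content (@dyadic R d) (fun n => (((2 : R) `^ (- s)) ^+ n)%R) E)%E.
Proof.
move=> s0 HE; set z : R := 2 `^ (- s).
have z0 : 0 < z by rewrite powR_gt0.
have z1 : z < 1 by rewrite /z powRN invf_lt1 ?powR_gt0// powR2_gt1.
have g0 n : 0 <= z ^+ n by rewrite exprn_ge0// ltW.
rewrite lt_neqAle net_content_ge0// andbT; apply/eqP => c0; apply: HE.
apply: hausdorff_measure_eq0 => delta e delta0 e0.
have d0 : 0 < d%:R :> R by rewrite ltr0n.
have [m md] := exp2N_small (divr_gt0 delta0 d0).
pose C := (d%:R : R) `^ s; have C0 : 0 < C by rewrite powR_gt0.
(* The bound z^m forces generations beyond m, hence diameters below [delta]; the bound e / C makes
   the Hausdorff sum at most e. *)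
have e1 : 0 < Num.min (z ^+ m) (e / C) by rewrite lt_min exprn_gt0//= divr_gt0.
have [_ [U UE <-]] : exists2 u, [set net_mass (fun n => z ^+ n) U |
     U in [set U | net_cover (@dyadic R d) U E]] u & (u < (Num.min (z ^+ m) (e / C))%:E)%E.
  by apply: ereal_inf_lt; rewrite -/(net_content _ _ _) -c0 lte_fin.
move=> Ulte.
pose Q (p : nat * 'rV[int]_d) : set 'rV[R]_d := [set x | U p /\ dyadic p.1 x = p.2].
pose V k := oapp Q set0 (pickle_inv k).
have Qdiam p c : d%:R * 2 ^- p.1 <= c -> (ediam (Q p) <= c%:E)%E.
  move=> pc; apply: ediam_le => x y [_ xp] [_ yp]; apply: le_trans pc.
  by apply: dyadic_enorm_le; rewrite xp yp.
have Um p : U p -> (m < p.1)%N.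
  move=> Up; have zp : z ^+ p.1 < z ^+ m.
    rewrite -lte_fin; apply: lt_le_trans (_ : (Num.min (z ^+ m) (e / C))%:E <= _)%E; last first.
      by rewrite lee_fin ge_min lexx.
    apply: le_lt_trans Ulte; rewrite -(@esum_set1 _ _ p (fun p => (z ^+ p.1)%:E)) ?lee_fin//.
    by apply: (@le_net_mass _ _ (fun n => z ^+ n)) => // _ ->.
  rewrite ltnNge; apply/negP => pm; move: zp; rewrite ltNge; apply/negP/negPn.
  by rewrite ler_wiXn2l// ltW.
apply: (@le_trans _ _ (\sum_(0 <= k <oo) hausdorff_gauge s (V k))%E).
  apply: ereal_inf_lbound; exists V => //; split => [k|x /UE[n Un]].
    rewrite /V; case: pickle_inv => [p|] /=; last by apply: ediam_le.
    have [Up|nUp] := pselect (U p); last by apply: ediam_le => x y [].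
    apply: Qdiam; rewrite -ler_pdivlMl// mulrC (le_trans _ (ltW md))//.
    by rewrite lef_pV2 ?posrE ?exprn_gt0// ler_weXn2l ?ler1n// ltnW// Um.
  by exists (pickle (n, dyadic n x)) => //; rewrite /V pickleK_inv.
pose v (p : nat * 'rV[int]_d) : \bar R := (if p \in U then (C * z ^+ p.1)%:E else 0)%E.
have v0 p : (0 <= v p)%E.
  by rewrite /v; case: ifP => // _; rewrite lee_fin mulr_ge0// ltW.
apply: (@le_trans _ _ (\sum_(0 <= k <oo) oapp v 0 (pickle_inv k))%E).
  apply: lee_nneseries => [k _ _|k _]; first exact: hausdorff_gauge_ge0.
  rewrite /V; case: pickle_inv => [p|] /=; last by rewrite /hausdorff_gauge eqxx.
  rewrite /v; case: ifPn => [/set_mem Up|].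
    have -> : C * z ^+ p.1 = (d%:R * 2 ^- p.1) `^ s.
      rewrite powRM ?invr_ge0 ?exprn_ge0// /C /z; congr *%R.
      rewrite -powR_mulrn ?powR_ge0// -powRrM mulNr mulrC -powR_invn// -powRrM.
      by rewrite mulNr.
    by apply: hausdorff_gauge_le; [exact: ltW|rewrite mulr_ge0// invr_ge0 exprn_ge0|exact: Qdiam].
  rewrite notin_setE => nUp; have -> : Q p = set0 by apply/seteqP; split => // x [].
  by rewrite /hausdorff_gauge eqxx.
rewrite nneseries_pickle// -(esum_mkcond U (fun p => (C * z ^+ p.1)%:E)).
apply: ge_ereal_sup => _ [F [Ffin FU] <-].
rewrite (eq_fsbigr (fun p => C%:E * (z ^+ p.1)%:E)%E) => [|p _]; last by rewrite EFinM.
rewrite -ge0_mule_fsumr => [|p]; last by rewrite lee_fin.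
rewrite -esum_fset//; last by move=> p _; rewrite lee_fin.
apply: (@le_trans _ _ (C%:E * (e / C)%:E)%E); last by rewrite -EFinM mulrC divfK ?gt_eqF.
apply: lee_wpmul2l; first by rewrite lee_fin ltW.
apply: le_trans (_ : (Num.min (z ^+ m) (e / C))%:E <= _)%E; last first.
  by rewrite lee_fin ge_min lexx orbT.
apply: le_trans (ltW Ulte); exact: (@le_net_mass _ _ (fun n => z ^+ n)).
Qed.

(** Here z = 2^-s for some s > d - 1 with nonzero s-dimensional measure. The inequality
    [2 ^+ d' * z < 1] is the form in which s > d - 1 is used from here on. *)
Lemma hausdorff_dim_net_content E : ((d%:R - 1)%:E < hausdorff_dim E)%E ->
  exists z t, [/\ 0 < z, 2 ^+ d' * z < 1, 0 < t &
    (t%:E < net_content (@dyadic R d) (fun n => (z ^+ n)%R) E)%E].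
Proof.
move=> dE.
have [s ds HE] : exists2 s, d%:R - 1 < s & hausdorff_measure s E <> 0%E.
  apply: contrapT => nE; move: dE; apply/negP; rewrite -leNgt.
  apply/lee_addgt0Pr => e e0; rewrite -EFinD; apply: ereal_inf_lbound.
  exists (d%:R - 1 + e) => //; split.
    by rewrite addr_ge0 ?(ltW e0)// subr_ge0 ler1n.
  by apply: contrapT => He; apply: nE; exists (d%:R - 1 + e); rewrite ?ltrDl.
have s0 : 0 < s by rewrite (le_lt_trans _ ds)// subr_ge0 ler1n.
have c0 := net_content_gt0 s0 HE.
have [t t0 tc] : exists2 t : R, 0 < t & (t%:E < net_content (@dyadic R d) (fun n => (((2 : R) `^ (- s)) ^+ n)%R) E)%E.
  move: c0; case: net_content => [r| |]//=; last by exists 1; rewrite ?ltry.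
  by rewrite lte_fin => r0; exists (r / 2); rewrite ?lte_fin; lra.
exists (2 `^ (- s)), t; split => //; rewrite ?powR_gt0//.
rewrite powRN ltr_pdivrMr ?powR_gt0// mul1r -(subrK d'%:R s) powRD ?pnatr_eq0 ?implybT//.
by rewrite powR_mulrn// ltr_pMl ?exprn_gt0// powR2_gt1// subr_gt0; move: ds; rewrite -natr1 addrK.
Qed.

End HausdorffContent.

(** * Conclusion *)

Lemma exists_expr_lt (R : realType) (rho eta : R) : 0 <= rho -> rho < 1 -> 0 < eta ->
  exists k, rho ^+ k <= eta.
Proof.
move=> rho0 rho1 eta0.
have : (rho ^+ k @[k --> \oo] --> 0) by apply: cvg_expr; rewrite ger0_norm.
move=> /cvgrPdist_le/(_ _ eta0)[k _ /(_ k (leqnn k))].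
by rewrite /= sub0r normrN ger0_norm ?exprn_ge0//; exists k.
Qed.

Lemma card_ge_le (R : realType) (V : finType) (f : V -> R) (theta s : R) :
  0 < theta -> (forall v, 0 <= f v) -> \sum_v f v <= s ->
  #|[set v | theta <= f v]%SET|%:R <= s / theta.
Proof.
move=> theta0 f0 fs; rewrite ler_pdivlMr//; apply: le_trans fs.
rewrite mulr_natl -sumr_const big_mkcond; apply: ler_sum => v _.
by rewrite inE; case: ifP.
Qed.

Lemma analytic_setI (T : topologicalType) (A B : set T) :
  analytic A -> analytic B -> analytic (A `&` B).
Proof.
move=> aA aB; have -> : A `&` B = \bigcap_j (if j is 0%N then A else B).
  apply/seteqP; split => [x [Ax Bx] [|j] _//|x ABx].
  by split; [exact: (ABx 0%N I)|exact: (ABx 1%N I)].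
by apply: analytic_bigcap => -[|j].
Qed.

Lemma closed_cube (R : realType) (d N : nat) : closed (@cube R d N).
Proof. apply: compact_closed; [exact: norm_hausdorff|exact: compact_cube]. Qed.

Lemma enorm_cube_le (R : realType) (d N M : nat) (y a : 'rV[R]_d.+1) :
  cube N y -> cube M a -> enorm (y - a) <= (d.+1 * (N + M))%N%:R.
Proof.
move=> yN aM; rewrite -(@ler_pXn2r _ 2) ?nnegrE ?enorm_ge0// enorm_sqr.
apply: le_trans (_ : \sum_(i < d.+1) (N%:R + M%:R) ^+ 2 <= _).
  apply: ler_sum => i _; rewrite !mxE -[X in X <= _]real_normK ?num_real//.
  by rewrite ler_pXn2r ?nnegrE// (le_trans (ler_normB _ _))// lerD.
rewrite sumr_const card_ord -[X in X <= _]mulr_natl natrM natrD exprMn ler_wpM2r ?exprn_ge0//.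
by rewrite expr2 ler_peMl// ler1n.
Qed.

Section Assembly.
Context (R : realType) (e N M : nat) (K : nat -> set 'rV[R]_e.+2) (z t : R).
Local Notation d := e.+2.
Hypothesis K_dec : forall m n, (m <= n)%N -> K n `<=` K m.
Hypothesis K_cube : K 0%N `<=` cube N.
Hypothesis z_gt0 : 0 < z.
Hypothesis z_small : 2 ^+ e.+1 * z < 1.
Hypothesis t_gt0 : 0 < t.
Hypothesis K_content :
  forall n, (t%:E < net_content (@dyadic R d) (fun n => (z ^+ n)%R) (K n))%E.

Let R1 := (d * (N + M))%N.
Let L : R := band_width R e.+1 N R1.
Let C : R := (2 * M%:R + 1) ^+ d * (2 * L + 1) * 3 ^+ d * t / (1 - 2 * z).

(** Each cell met by [K n] is represented by one of its points in [K n]; the other cells receive the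
    default point [x0], so that all atoms lie in [K n]. *)
Lemma discrete_measure n : exists (x : {ffun 'I_d -> 'I_(grid N n).+1} -> 'rV[R]_d)
    (w : {ffun 'I_d -> 'I_(grid N n).+1} -> R),
  [/\ forall j, K n (x j), forall j, 0 <= w j, \sum_j w j = t &
    forall l (Q : 'rV[int]_d), (l <= n)%N -> \sum_(j | dyadic l (x j) == Q) w j <= z ^+ l].
Proof.
have [x0 Kx0] : K n !=set0.
  apply/set0P/negP => /eqP Kn0; have := K_content n; rewrite Kn0 ltNge => /negP; apply.
  apply: (@le_trans _ _ (net_mass (fun n => z ^+ n) (set0 : set (nat * 'rV[int]_d)))).
    by apply: net_content_le.
  by rewrite /net_mass esum_set0 lee_fin ltW.
have /choice[x xP] (j : {ffun 'I_d -> 'I_(grid N n).+1}) : exists x, K n x /\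
    forall y, K n y -> cell N n y = j -> cell N n x = j.
  have [[y [Ky yj]]|nj] := pselect (exists y, K n y /\ cell N n y = j); first by exists y.
  by exists x0; split => // y Ky yj; exfalso; apply: nj; exists y.
have zn0 m : 0 <= z ^+ m by rewrite exprn_ge0// ltW.
have KN y : K n y -> cube N y by move=> Ky; exact/K_cube/(K_dec (leq0n n)).
have [|w [w0 wQ wt]] := @discrete_frostman R _ _ (@dyadic R d)
  (fun n => z ^+ n) _ x zn0 (@dyadic_nested R d) n (K n) t t_gt0 (K_content n).
  move=> y Ky; exists (cell N n y); have [Kx /(_ y Ky erefl) xy] := xP (cell N n y).
  exact: cell_dyadic (KN _ Kx) (KN _ Ky) xy.
by exists x, w; split => // j; case: (xP j).
Qed.

(** [A] collects the cells where the energy at scale 0 or at scale k is large, and Chebyshev's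
    inequality bounds its volume. Off [A], the first energy bounds the mass in thick shells by t / 2
    and the second keeps the mass in thin shells below t / 2, contradicting the total mass t. *)
Lemma level_set (k n : nat) (Lam : R) : 0 < Lam -> (k <= n)%N ->
  exists A : set 'rV[R]_d,
  [/\ caratheodory_measurable (@lebesgue_outer_measure R d) A,
      (lebesgue_outer_measure A <= (C / Lam + C * (2 * z) ^+ k *
         (4 * R1.+1%:R * (circle_cells e N k)%:R / t ^+ 2))%:E)%E &
      forall a, cube M a ->
        #|[set s : 'I_(R1 * 2 ^ n).+1 | `[< ~ thin N K a k n s >]]%SET|%:R * 2 ^- n *
          ((grid N 0).+1 ^ d)%N%:R * Lam <= t ^+ 2 / 4 ->
        A a].
Proof.
move=> Lam0 kn; have [x [w [Kx w0 wt wQ]]] := discrete_measure n.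
have z2 : 2 * z < 1.
  by apply: le_lt_trans z_small; rewrite ler_pM2r// exprS ler_peMr// exprn_ege1// ler1n.
have L0 : 0 <= L by rewrite /L /band_width addr_ge0 ?mulr_ge0.
have h0 m : 0 < 2 ^+ m :> R by rewrite exprn_gt0.
pose En l (p : {ffun 'I_d -> 'I_(grid M n).+1}) := 2 ^+ n * pair_energy x w L l p.
have En0 l p : 0 <= En l p.
  rewrite mulr_ge0 ?(ltW (h0 n))//; apply: sumr_ge0 => i _; apply: sumr_ge0 => j _.
  by rewrite mulr_ge0.
have En_sum l : (l <= n)%N -> \sum_p En l p <= 2 ^+ (n * d) * (C * (2 * z) ^+ l).
  move=> ln; rewrite -mulr_sumr.
  have := @sum_pair_energy R e.+1 n _ x w z t w0 (ltW z_gt0) wt wQ M L l L0 ln z2.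
  rewrite -[leLHS]mulrA mulrCA ler_pdivrMl ?h0// => /le_trans; apply.
  by rewrite ler_pM2l ?h0// /C [leRHS]mulrAC -[leRHS]mulrA.
pose P_k : R := (circle_cells e N k)%:R.
have Pk0 : 0 < P_k.
  by rewrite ltr0n /circle_cells !muln_gt0 expn_gt0.
(* Chosen so that the number of shells, bounded by (R1 + 1) 2^n, turns the Cauchy-Schwarz bound for
   the thin shells into exactly (t / 2)^2. *)
pose theta := t ^+ 2 / (4 * R1.+1%:R * P_k).
have theta0 : 0 < theta by rewrite divr_gt0 ?exprn_gt0 ?mulr_gt0.
pose P := ([set p | (Lam <= En 0 p)%R] :|: [set p | (theta <= En k p)%R])%SET.
exists (cell_union P); split; first exact: caratheodory_cell_union.
  apply: le_trans (cell_union_le R P) _; rewrite lee_fin.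
  rewrite ler_pdivrMr ?h0//.
  apply: le_trans (_ : #|[set p | Lam <= En 0 p]%SET|%:R + #|[set p | theta <= En k p]%SET|%:R <= _).
    by rewrite -natrD ler_nat cardsU leq_subr.
  rewrite mulrDl; apply: lerD.
    apply: le_trans (card_ge_le Lam0 (En0 0%N) (En_sum _ (leq0n n))) _.
    by rewrite expr0 mulr1 -[leLHS]mulrA [leLHS]mulrC.
  apply: le_trans (card_ge_le theta0 (En0 k) (En_sum _ kn)) _.
  by rewrite /theta invf_div -/P_k -[leLHS]mulrA [leLHS]mulrC.
move=> a aM thick_small; apply: cell_unionP => //; apply: contrapT => /negP.
rewrite !inE negb_or -!ltNge => /andP[E0 Ek].
set S := [set s : 'I_(R1 * 2 ^ n).+1 | `[< ~ thin N K a k n s >]]%SET in thick_small.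
have KN : K n `<=` cube N by move=> y Ky; exact/K_cube/(K_dec (leq0n n)).
have KR y : K n y -> enorm (y - a) <= R1%:R by move=> /KN yN; exact: enorm_cube_le.
(* At scale 0 the trivial count of all cells serves for the thick shells; their small number
   compensates. *)
have thick_le := @shell_mass_le R e.+1 n M N R1 a aM _ x w (K n) S 0%N
  ((grid N 0).+1 ^ d)%N w0 Kx KN KR.
have thin_le := @shell_mass_le R e.+1 n M N R1 a aM _ x w (K n) (~: S)%SET k
  (circle_cells e N k) w0 Kx KN KR.
set m1 := \sum_(j | _) w j in thick_le; set m2 := \sum_(j | _) w j in thin_le.
have m10 : 0 <= m1 by exact: sumr_ge0.
have m20 : 0 <= m2 by exact: sumr_ge0.
have m1_le : m1 <= t / 2.
  rewrite -(@ler_pXn2r _ 2) ?nnegrE ?divr_ge0 ?(ltW t_gt0)//.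
  apply: le_trans (thick_le _) _.
    move=> s _; rewrite (leq_trans (max_card _))// card_ffun !card_ord//.
  have -> : (t / 2) ^+ 2 = t ^+ 2 / 4 by field.
  apply: le_trans thick_small.
  set PE := pair_energy _ _ _ _ _; set P0 : R := (_ ^ d)%N%:R.
  have -> : #|S|%:R * P0 * PE = #|S|%:R * 2 ^- n * P0 * En 0%N (cell M n a).
    by rewrite /En -/PE; field; rewrite gt_eqF.
  by rewrite ler_wpM2l ?(ltW E0)// !mulr_ge0// invr_ge0 ltW.
have m2_lt : m2 < t / 2.
  rewrite -(@ltr_pXn2r _ 2) ?nnegrE ?divr_ge0 ?(ltW t_gt0)//.
  apply: le_lt_trans (thin_le _) _.
    by move=> s; rewrite !inE => /asboolP; apply: contra_notP.
  set PE := pair_energy _ _ _ _ _.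
  have PE0 : 0 <= PE.
    by apply: sumr_ge0 => i _; apply: sumr_ge0 => j _; rewrite mulr_ge0.
  apply: le_lt_trans (_ : R1.+1%:R * P_k * En k (cell M n a) < _).
    rewrite /En -/PE; have -> : R1.+1%:R * P_k * (2 ^+ n * PE) = R1.+1%:R * 2 ^+ n * P_k * PE by ring.
    rewrite ler_wpM2r// ler_wpM2r// -natrX -natrM ler_nat.
    by rewrite (leq_trans (max_card _))// card_ord mulSn -add1n leq_add2r expn_gt0.
  have -> : (t / 2) ^+ 2 = R1.+1%:R * P_k * theta.
    by rewrite /theta; field; rewrite !gt_eqF.
  by rewrite ltr_pM2l// mulr_gt0.
have : t <= m1 + m2.
  rewrite -wt /m1 /m2 [X in _ <= X + _]big_mkcond [X in _ <= _ + X]big_mkcond -big_split; apply: ler_sum => j _ /=.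
  pose r := Num.truncn (2 ^+ n * enorm (x j - a)).
  have rlt : (r < (R1 * 2 ^ n).+1)%N.
    rewrite ltnS truncn_le_nat; apply: (@le_lt_trans _ _ (R1 * 2 ^ n)%:R); last by rewrite ltr_nat.
    by rewrite natrM natrX mulrC ler_pM2r// KR.
  have [rS|rS] := boolP (Ordinal rlt \in S).
    rewrite asboolT; last by exists (Ordinal rlt).
    by rewrite lerDl; case: ifP.
  rewrite [X in _ + X]ifT; first by rewrite lerDr; case: ifP.
  by apply/asboolP; exists (Ordinal rlt); rewrite // inE.
by lra.
Qed.

End Assembly.

(** Since [circle_cells] is of order 2^(ke), the product is dominated by a multiple of the k-th
    power of 2^(e+1) z, which is below 1. *)
Lemma exists_level_bound (R : realType) (e N : nat) (D z eta : R) :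
  0 <= D -> 0 < z -> 2 ^+ e.+1 * z < 1 -> 0 < eta ->
  exists k, D * ((2 * z) ^+ k * (circle_cells e N k)%:R) <= eta.
Proof.
move=> D0 z0 z1 eta0.
pose B : R := (e.+1 * 2 * ((3 * e).+4 * (6 * e).+4))%N%:R * (2 * N%:R + 1) ^+ e.
have B0 : 0 <= B by rewrite mulr_ge0// exprn_ge0// addr_ge0// mulr_ge0.
have rho0 : 0 <= 2 ^+ e.+1 * z by rewrite mulr_ge0 ?exprn_ge0// ltW.
have DB0 : 0 < D * B + 1 by rewrite ltr_wpDl// mulr_ge0.
have [k kle] := exists_expr_lt rho0 z1 (divr_gt0 eta0 DB0).
exists k; rewrite ler_pdivlMr// mulrC in kle; apply: le_trans kle.
apply: le_trans (_ : D * (B * (2 ^+ e.+1 * z) ^+ k) <= _); last first.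
  by rewrite mulrA ler_wpM2r ?exprn_ge0// lerDl.
rewrite ler_wpM2l//.
have -> : B * (2 ^+ e.+1 * z) ^+ k = (2 * z) ^+ k *
    ((e.+1 * 2 * ((3 * e).+4 * (6 * e).+4))%N%:R * ((2 * N%:R + 1) * 2 ^+ k) ^+ e).
  by rewrite /B !exprMn -!exprM mulSn exprD (mulnC k e); ring.
have zk : 0 <= (2 * z) ^+ k by rewrite exprn_ge0// mulr_ge0// ltW.
rewrite ler_wpM2l// /circle_cells mulnAC natrM ler_wpM2l//.
have b0 : 0 <= (2 * N%:R + 1) * 2 ^+ k :> R := le_trans (ler0n _ _) (grid_le R N k).
by rewrite natrX lerXn2r ?nnegrE ?grid_le.
Qed.

(** For a given [eta], the level sets [A n] have measure at most [eta] once n >= k. Each centre in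
    question has a vanishing proportion of thick shells, so it belongs to [A n] for all n beyond a
    rank of its own, that is, to the lower limit of the [A n]. *)
Lemma few_spheres_null (R : realType) (e N M : nat) (E : set 'rV[R]_e.+2)
    (K : nat -> set 'rV[R]_e.+2) (z t : R) :
  (forall n, closed (K n)) -> (forall m n, (m <= n)%N -> K n `<=` K m) ->
  K 0%N `<=` cube N -> \bigcap_n K n `<=` E ->
  0 < z -> 2 ^+ e.+1 * z < 1 -> 0 < t ->
  (forall n, (t%:E < net_content (@dyadic R e.+2) (fun n => (z ^+ n)%R) (K n))%E) ->
  lebesgue_outer_measure [set a | cube M a /\
    lebesgue_measure [set r : R | 0 < r /\ set_determines_sphere E a r] = 0%E] = 0%E.
Proof.
move=> Kcl Kdec Kcube KE z0 z1 t0 Kt.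
apply/le_anti; rewrite outer_measure_ge0 andbT; apply/lee_addgt0Pr => eta eta0; rewrite add0e.
pose R1 := (e.+2 * (N + M))%N.
pose L : R := band_width R e.+1 N R1.
pose C : R := (2 * M%:R + 1) ^+ e.+2 * (2 * L + 1) * 3 ^+ e.+2 * t / (1 - 2 * z).
have z2 : 2 * z < 1.
  by apply: le_lt_trans z1; rewrite ler_pM2r// exprS ler_peMr// exprn_ege1// ler1n.
have C0 : 0 <= C.
  rewrite divr_ge0 ?subr_ge0 ?(ltW z2)// mulr_ge0 ?(ltW t0)// mulr_ge0 ?exprn_ge0//.
  by rewrite mulr_ge0 ?exprn_ge0 ?addr_ge0 ?mulr_ge0 ?addr_ge0 ?mulr_ge0.
have C1 : 0 < 2 * C + 1 by rewrite ltr_wpDl// mulr_ge0.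
(* This makes C / Lam at most eta / 2; the added 1 keeps [Lam] positive even if C = 0. *)
pose Lam := (2 * C + 1) / eta.
have Lam0 : 0 < Lam by rewrite divr_gt0.
have eta2 : 0 < eta / 2 by rewrite divr_gt0.
have D0 : 0 <= C * (4 * R1.+1%:R / t ^+ 2) by rewrite mulr_ge0// divr_ge0 ?exprn_ge0 ?mulr_ge0// ltW.
have [k kle] := exists_level_bound N D0 z0 z1 eta2.
have /choice[A AP] n : exists A : set 'rV[R]_e.+2,
    caratheodory_measurable (@lebesgue_outer_measure R e.+2) A /\ ((k <= n)%N ->
      (lebesgue_outer_measure A <= eta%:E)%E /\ forall a, cube M a ->
        #|[set s : 'I_(R1 * 2 ^ n).+1 | `[< ~ thin N K a k n s >]]%SET|%:R * 2 ^- n *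
          ((grid N 0).+1 ^ e.+2)%N%:R * Lam <= t ^+ 2 / 4 -> A a).
  have [kn|nk] := leqP k n; last by exists set0; split => //; exact: caratheodory_measurable_set0.
  have [A [mA Ale Aa]] := @level_set R e N M K z t Kdec Kcube z0 z1 t0 Kt k n Lam Lam0 kn.
  exists A; split => // _; split => //; apply: le_trans Ale _; rewrite lee_fin.
  have -> : eta = eta / 2 + eta / 2 by field.
  rewrite -/R1 -/L -/C; apply: lerD.
    rewrite /Lam invf_div mulrCA ler_pM2l//.
    by rewrite ler_pdivrMr//; lra.
  apply: le_trans kle; rewrite le_eqVlt; apply/orP; left; apply/eqP.
  by field; rewrite gt_eqF.
apply: le_trans (outer_measure_liminf (fun n => (AP n).1) (fun n kn => ((AP n).2 kn).1)).
apply: le_outer_measure => a [aM Ta].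
pose P0 : R := ((grid N 0).+1 ^ e.+2)%N%:R.
have P00 : 0 < P0 by rewrite ltr0n expn_gt0.
(* The proportion of thick shells tolerated by [level_set]. *)
have e0 : 0 < t ^+ 2 / 4 / (P0 * Lam) 
  by rewrite (divr_gt0 (divr_gt0 (exprn_gt0 2 t0) _) (mulr_gt0 P00 Lam0)).
have [r k' n r0 kn nthin| r r0 bad|n0 n0P] := @few_dyadic_intervals R (fun n s => ~ thin N K a k n s)
  [set r : R | 0 < r /\ set_determines_sphere E a r] R1 _ _ Ta _ e0.
- by apply: contra_not nthin; exact: thin_nested.
- apply: contrapT => /(thin_eventually Kcl Kdec Kcube KE k r0)[n]; exact: bad.
exists (maxn n0 k) => n; rewrite geq_max => /andP[nn0 kn].
apply: ((AP n).2 kn).2 => //; have := n0P n nn0.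
by rewrite (ler_pdivlMr _ _ (mulr_gt0 P00 Lam0)) mulrA.
Qed.

Unset Implicit Arguments.

(* On a set that is not Borel, [lebesgue_measure] is by definition the Lebesgue
   outer measure, which agrees with the completed Lebesgue measure. *)
Theorem theorem1p3 (R : realType) (d : nat) (E : set 'rV[R]_d) :
  (2 <= d)%N ->
  borel E ->
  ((d%:R - 1)%:E < hausdorff_dim E)%E ->
  lebesgue_ae (fun a : 'rV[R]_d =>
    (0 < lebesgue_measure
           [set r : R | (0 < r)%R /\ set_determines_sphere E a r])%E).
Proof.
case: d E => [//|[//|e]] E _ Eborel /hausdorff_dim_net_content[z [t [z0 z1 t0 tE]]].
set c := net_content _ _ in tE.
have zn0 n : 0 <= z ^+ n by rewrite exprn_ge0// ltW.
have c_bigcup := @net_content_bigcup R _ _ (@dyadic R e.+2) (fun n => z ^+ n) zn0 (@dyadic_nested R e.+2).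
(* By continuity along increasing unions, a bounded part of [E] already has content above [t];
   boundedness supplies the compactness needed later. *)
have [N tEN] : exists N, (t%:E < c (E `&` cube N))%E.
  apply: contrapT => /forallNP nN; move: tE; apply/negP; rewrite -leNgt.
  have -> : E = \bigcup_N (E `&` cube N).
    apply/seteqP; split => [x Ex|x [N _ []//]].
    exists (Num.truncn (\sum_i `|x ord0 i|)).+1 => //; split => // i.
    apply: le_trans (ltW (truncnS_gt _)); rewrite (bigD1 i)//= lerDl.
    by apply: sumr_ge0.
  apply: c_bigcup => [m n mn x [Ex xm]|n]; last by rewrite leNgt; apply/negP.
  by split => // i; rewrite (le_trans (xm i))// ler_nat.
have aEN : analytic (E `&` cube N).
  by apply: analytic_setI; [exact: borel_analytic|exact/analytic_closed/closed_cube].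
have le_c A B : A `<=` B -> (c A <= c B)%E by exact: le_net_content.
have [K [Kcl Kdec Kt KE]] := capacitability le_c c_bigcup aEN tEN.
rewrite /lebesgue_ae.
have -> : [set a : 'rV[R]_e.+2 | ~ (0 < lebesgue_measure
    [set r : R | (0 < r)%R /\ set_determines_sphere E a r])%E] =
  \bigcup_M [set a | cube M a /\ lebesgue_measure
    [set r : R | (0 < r)%R /\ set_determines_sphere E a r] = 0%E].
  apply/seteqP; split => a; last first.
    by move=> [M _ [_ /= a0]] /=; rewrite a0 ltxx.
  move=> /= /negP; rewrite -leNgt => a0.
  exists (Num.truncn (\sum_i `|a ord0 i|)).+1 => //; split.
    move=> i; apply: le_trans (ltW (truncnS_gt _)); rewrite (bigD1 i)//= lerDl.
    by apply: sumr_ge0.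
  by apply/le_anti; rewrite a0 measure_ge0.
apply: outer_measure_bigcup0 => M.
apply: (@few_spheres_null R e N M E (fun n => K n `&` cube N) z t) => //.
- by move=> n; apply: closedI; [exact: Kcl|exact: closed_cube].
- by move=> m n mn x [Kx xN]; split => //; exact: Kdec mn _ Kx.
- move=> x Kx; suff : (E `&` cube N) x by case.
  by apply: KE => n _; case: (Kx n I).
- move=> n; apply: lt_le_trans (Kt n) _; apply: le_c => x [Kx [_ xN]]; by split.
Qed.
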